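(* For every $\delta>0$ there exists a constant $C<\infty$ depending only on $\delta$ such that the following holds. Let $T>0$ and suppose $u:B\times[0,T)\to(0,\infty)$ is a smooth solution to the equation $\partial_t u=\Delta\log u$ on the unit ball $B\subset\mathbb{R}^2$, with initial data $u_0:=u(0)$, and suppose that $(u_0-\alpha h)_+\in L^1(B)$ for some $\alpha\ge 0$. Then for any time $t\in[0,T)$ satisfying $$t\ge\frac{\|(u_0-\alpha h)_+\|_{L^1(B)}}{4\pi}(1+\delta),$$ we have $$\sup_B\frac{u(t)}{h}\le 2t+C\left(\alpha+\|(u_0-\alpha h)_+\|_{L^1(B)}\right).$$
   Context: $B=\{\mathbf{x}\in\mathbb{R}^2:|\mathbf{x}|<1\}$ is the open unit ball. The function $$h(\mathbf{x}):=\left(\frac{2}{1-|\mathbf{x}|^2}\right)^2$$ is the conformal factor of the complete hyperbolic (Poincaré) metric on $B$. $\Delta$ is the Euclidean Laplacian in the spatial variable, $u(t)$ denotes the function $u(\cdot,t)$ on $B$, $(\cdot)_+=\max\{\cdot,0\}$, and $L^1(B)$ is taken with respect to (Euclidean) Lebesgue measure. No further condition is imposed on $u$ near $\partial B$. *)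

(* Defs.v *)
From mathcomp Require Import all_boot all_order all_algebra.
From mathcomp Require Import all_classical all_reals all_analysis.
Import Order.TTheory GRing.Theory Num.Theory.
Import numFieldNormedType.Exports.

Set Implicit Arguments.
Unset Strict Implicit.
Unset Printing Implicit Defensive.

Local Open Scope classical_set_scope.
Local Open Scope ring_scope.

(* The library norm on [R * R] is the max norm, hence a separate Euclidean
   norm. *)
Definition enorm (R : realType) (x : R * R) : R :=
  Num.sqrt (x.1 ^+ 2 + x.2 ^+ 2).

Definition unit_disc (R : realType) : set (R * R) := [set x | enorm x < 1].

Definition hyp_factor (R : realType) (x : R * R) : R :=
  (2 / (1 - enorm x ^+ 2)) ^+ 2.

Definition lebesgue2 (R : realType) :=
  ((@lebesgue_measure R) \x (@lebesgue_measure R))%E.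

Definition laplacian (R : realType) (f : R * R -> R) (x : R * R) : R :=
  'D_((1, 0) : R * R) ('D_((1, 0) : R * R) f) x
  + 'D_((0, 1) : R * R) ('D_((0, 1) : R * R) f) x.

(* Class C^k on an open set [U]; the values of [f] outside [U] are irrelevant
   because [U] is open. *)
Fixpoint Ck_on (R : realType) (V : normedModType R) (k : nat) (U : set V)
    (f : V -> R) : Prop :=
  (forall p, U p -> {for p, continuous f}) /\
  match k with
  | 0%N => True
  | k'.+1 => forall v : V,
      (forall p, U p -> derivable f p v) /\ Ck_on k' U ('D_v f)
  end.

(* Smoothness on a set [A] that need not be open (here [B x [0, T)]): near each
   point of [A], [f] agrees on [A] with a C^oo function on an open set. *)
Definition smooth_on (R : realType) (V : normedModType R) (A : set V)
    (f : V -> R) : Prop :=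
  forall p, A p -> exists (U : set V) (g : V -> R),
    [/\ open U, U p, (forall k, Ck_on k U g)
      & forall q, U q -> A q -> g q = f q].

(* The time derivative is taken within [[0, T)], so it is one-sided at
   [t = 0], where [u] is not defined for negative times. *)
Definition log_diffusion (R : realType) (T : R) (u : R * R -> R -> R) : Prop :=
  forall (x : R * R) (t : R), unit_disc x -> 0 <= t < T ->
    (u x s - u x t) / (s - t) @[s --> within `[0, T[ t^']
      --> laplacian (fun y => ln (u y t)) x.

Definition excess (R : realType) (alpha : R) (f : R * R -> R) (x : R * R) : R :=
  Num.max (f x - alpha * hyp_factor x) 0.

Definition L1norm (R : realType) (f : R * R -> R) : R :=
  (\int[@lebesgue2 R]_(x in @unit_disc R) `|f x|)%R.

(* Main.v *)
(* Write h for the hyperbolic factor of a disc of radius rho < 1 (the general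
   case follows by letting rho tend to 1).  Two elementary facts carry the proof.

   (1) Smoothing.  If u(0) <= alpha h - Delta psi with psi >= 0, then
   u(t) <= e (2t + beta) h exp(psi / t) for beta > alpha.  For a maximal solution
   this is the Aronson-Benilan inequality u(s) >= (s/t) u(t) combined with
   int_0^t log u(s) ds <= psi + int_0^t log((2s + beta) h) ds; the latter is the
   maximum principle, because Delta int_0^t log u = u(t) - u(0).  An arbitrary
   solution violates Aronson-Benilan near the boundary, but its envelope
   v(s) = sup_{s <= s' <= t} (s / s') u(s') satisfies it, and it is a subsolution
   in the viscosity sense; a geometric time grid turns the argument into finite
   sums and maxima.

   (2) Bounded potentials.  Discretize the excess of u(0) over alpha h into point
   masses c_i at y_i with total mass about N, regularise at scale eps, and
   truncate the logarithmic potential at the scale lambda d(y_i), where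
   lambda^2 = N / (alpha + N) and d = (rho^2 - |y|^2) / rho.  At time
   t_0 = (1 + delta/4) N / (4 pi) the smoothing estimate and Jensen bound u(t_0)/h
   by a combination of powers |x - y_i|^(-2q) with q < 1.  These have an explicit
   potential of size C N, so a second application of (1), for a time
   delta N / (16 pi), gives u <= C (alpha + N) h.  Afterwards u is compared with
   the solution (2t + beta) h. *)

Require Import Defs.
From mathcomp Require Import all_boot all_order all_algebra.
From mathcomp Require Import all_classical all_reals all_analysis.
From mathcomp Require Import measurable_realfun ring lra.
Import Order.TTheory GRing.Theory Num.Theory.
Import numFieldNormedType.Exports.
Local Open Scope classical_set_scope.
Local Open Scope ring_scope.

Set Implicit Arguments.
Unset Strict Implicit.
Unset Printing Implicit Defensive.

(** * Second directional derivatives and the pointwise Laplacian *)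

Section SecondDerivative.
Variable R : realType.
Implicit Types (f g : R -> R) (a b : R).

(** Nothing is known of [u] at the unit circle, so every maximum principle is run on a disc of
    radius rho < 1, where [u] is bounded by compactness while h blows up: the comparison function
    itself supplies the boundary condition. The threshold comes from (1). A mass c has potential -(c
    / (2 pi)) ln |x|, so exp(psi / t) is singular like |x|^(-2q) with q = N / (4 pi t) when all the
    mass sits at one point. For q < 1, that is t > N / (4 pi), this singularity has a bounded
    potential of the type |x|^(2 - 2q). The scale lambda balances two costs. Truncating at lambda d
    leaves an error N h / lambda^2 = (alpha + N) h in the Laplacian, while the second potential has
    size C (alpha + N) lambda^2 = C N, comparable with the time left for it, so exp(psi / t) stays
    bounded uniformly in alpha. Both applications together spend (1 + delta/2) N / (4 pi); the rest
    of delta pays for replacing N by N + e, which also covers N = 0. *)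

Definition second_derivative g a : Prop :=
  exists g1 : R -> R,
    (\forall r \near (0 : R), is_derive r (1:R) g (g1 r)) /\ is_derive (0:R) (1:R) g1 a.

Lemma second_derivativeD f g a b :
  second_derivative f a -> second_derivative g b ->
  second_derivative (fun r => f r + g r) (a + b).
Proof.
move=> [f1 [nf df]] [g1 [ng dg]]; exists (fun r => f1 r + g1 r); split.
  near=> r.
  have hf : is_derive r (1:R) f (f1 r) by near: r.
  have hg : is_derive r (1:R) g (g1 r) by near: r.
  exact: is_deriveD.
exact: is_deriveD.
Unshelve. all: by end_near. Qed.

Lemma second_derivativeZ k f a :
  second_derivative f a -> second_derivative (fun r => k * f r) (k * a).
Proof.
move=> [f1 [nf df]]; exists (fun r => k * f1 r); split.
  near=> r.
  have hf : is_derive r (1:R) f (f1 r) by near: r.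
  exact: is_deriveZ.
exact: is_deriveZ.
Unshelve. all: by end_near. Qed.

Lemma second_derivative_cst c : second_derivative (fun=> c : R) 0.
Proof.
exists (fun=> 0); split; last exact: is_derive_cst.
by near=> r; exact: is_derive_cst.
Unshelve. all: by end_near. Qed.

Lemma near_eq_second_derivative f g a :
  (\forall r \near (0 : R), f r = g r) ->
  second_derivative f a -> second_derivative g a.
Proof.
move=> fg [f1 [nf df]]; exists f1; split=> //.
have fg' := near_join fg.
near=> r.
have hf : is_derive r (1:R) f (f1 r) by near: r.
apply: (near_eq_is_derive _ hf).
by near: r.
Unshelve. all: by end_near. Qed.

(** If [a > 0], then [g1], which vanishes at the maximum, is positive just to the right of 0, and
    the mean value theorem makes [g] exceed [g 0] there. *)
Lemma second_derivative_max g a :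
  second_derivative g a -> (\forall r \near (0 : R), g r <= g 0) -> a <= 0.
Proof.
move=> [g1 [ng dg]] gmax; rewrite leNgt; apply/negP => a0.
have g10 : g1 0 = 0.
  have /nbhs_ballP[e /= e0 he] : \forall r \near (0:R),
      is_derive r (1:R) g (g1 r) /\ g r <= g 0 by apply: filterI.
  have i0 : (0:R) \in `]- e, e[ by rewrite in_itv /= oppr_lt0 e0.
  have ball_of t : t \in `]- e, e[ -> ball (0:R) e t.
    by rewrite in_itv /= -ball_normE /= => /andP[? ?]; rewrite sub0r normrN ltr_norml; apply/andP; split.
  have h : is_derive (0:R) (1:R) g 0.
    apply: (@derive1_at_max _ g (- e) e 0) => //.
    - by lra.
    - by move=> t /ball_of /he [[]].
    - by move=> t /ball_of /he [].
  have [[_ E1] _] := he 0 (ballxx _ e0).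
  by rewrite -E1; exact: (@derive_val _ _ _ _ _ _ _ h).
have [dg1 dg1E] := dg.
have : h^-1 *: (g1 (h + 0) - g1 0) @[h --> 0^'] --> a.
  by rewrite -dg1E; have := dg1; rewrite /derivable /derive; under eq_fun do rewrite /= [_%:A]mulr1.
move=> /cvgr_gt /(_ 0 a0); rewrite near_withinE => pos.
have /nbhs_ballP[e /= e0 he] : \forall r \near (0:R),
    (is_derive r (1:R) g (g1 r) /\ g r <= g 0) /\
    (r != 0 -> 0 < r^-1 *: (g1 (r + 0) - g1 0)).
  by apply: filterI => //; apply: filterI.
have e20 : 0 < e / 2 by lra.
have ball_of t : 0 < t -> t < e -> ball (0:R) e t.
  by move=> t0 te; rewrite -ball_normE /= sub0r normrN gtr0_norm.
have [c] : exists2 c, c \in `]0, e/2[%R & g (e/2) - g 0 = g1 c * (e/2 - 0).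
  apply: MVT => //.
    move=> x; rewrite in_itv /= => /andP[x0 xe].
    by have [[]] := he x (ball_of x x0 ltac:(lra)).
  apply: derivable_within_continuous => x; rewrite in_itv /= => /andP[x0 xe].
  case: (ltgtP 0 x) x0 => // [x0 _|<- _].
    by have [[[]]] := he x (ball_of x x0 ltac:(lra)).
  by have [[[]]] := he 0 (ballxx _ e0).
rewrite in_itv /= => /andP[c0 ce] E.
have ce' : c < e by lra.
have [_] := he c (ball_of c c0 ce').
move=> /(_ (lt0r_neq0 c0)); rewrite addr0 g10 subr0 /GRing.scale /= => hc.
have g1c : 0 < g1 c by move: hc; rewrite pmulr_rgt0 ?invr_gt0.
have [[_ le0] _] := he (e/2) (ball_of (e/2) e20 ltac:(lra)).
have : 0 < g1 c * (e / 2 - 0) by rewrite subr0 mulr_gt0.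
by rewrite -E subr_gt0 ltNge le0.
Qed.

End SecondDerivative.

Section Laplacian.
Variable R : realType.
Implicit Types (f g : R * R -> R) (x : R * R).

(** A relation, so that a value comes with the existence of the derivatives behind it; [laplacian],
    built on the total ['D], gives no such guarantee. *)
Definition has_laplacian f x l : Prop :=
  exists a b, [/\ second_derivative (fun r => f (x.1 + r, x.2)) a,
    second_derivative (fun r => f (x.1, x.2 + r)) b & l = a + b].

Lemma has_laplacianD f g x l m : has_laplacian f x l -> has_laplacian g x m ->
  has_laplacian (fun y => f y + g y) x (l + m).
Proof.
move=> [a [b [ha hb ->]]] [c [d [hc hd ->]]]; exists (a + c), (b + d).
by split; [exact: second_derivativeD ha hc|exact: second_derivativeD hb hd|rewrite addrACA].
Qed.

Lemma has_laplacianZ k f x l : has_laplacian f x l ->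
  has_laplacian (fun y => k * f y) x (k * l).
Proof.
move=> [a [b [ha hb ->]]]; exists (k * a), (k * b).
by split; [exact: second_derivativeZ ha|exact: second_derivativeZ hb|rewrite mulrDr].
Qed.

Lemma has_laplacian_cst c x : has_laplacian (fun=> c) x 0.
Proof.
by exists 0, 0; split; [exact: second_derivative_cst..|rewrite addr0].
Qed.

Lemma has_laplacianB f g x l m : has_laplacian f x l -> has_laplacian g x m ->
  has_laplacian (fun y => f y - g y) x (l - m).
Proof.
move=> hf hg; rewrite -[- m]mulN1r.
under [X in has_laplacian X]eq_fun do rewrite -[- g _]mulN1r.
exact/has_laplacianD/has_laplacianZ.
Qed.

Lemma has_laplacian_sum (I : Type) (s : seq I) (F : I -> R * R -> R) (l : I -> R) x :
  (forall i, has_laplacian (F i) x (l i)) ->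
  has_laplacian (fun y => \sum_(i <- s) F i y) x (\sum_(i <- s) l i).
Proof.
move=> hF; elim: s => [|i s IH].
  rewrite big_nil; under [X in has_laplacian X]eq_fun do rewrite big_nil.
  exact: has_laplacian_cst.
rewrite big_cons; under [X in has_laplacian X]eq_fun do rewrite big_cons.
exact: has_laplacianD.
Qed.

Lemma has_laplacian_max f x l : has_laplacian f x l ->
  (\forall y \near x, f y <= f x) -> l <= 0.
Proof.
move=> [a [b [ha hb ->]]] fm; rewrite -[0]addr0; apply: lerD.
  apply: (second_derivative_max ha); rewrite /= addr0 -surjective_pairing.
  have c : (x.1 + r, x.2) @[r --> (0:R)] --> x.
    rewrite [X in _ --> X](_ : x = (x.1 + 0, x.2)); last first.
      by rewrite addr0 -surjective_pairing.
    apply: (@cvg_pair _ _ _ _ (nbhs (x.1 + 0)) (nbhs x.2)); last exact: cvg_cst.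
    by apply: cvgD; [exact: cvg_cst|exact: cvg_id].
  exact: (c _ fm).
apply: (second_derivative_max hb); rewrite /= addr0 -surjective_pairing.
have c : (x.1, x.2 + r) @[r --> (0:R)] --> x.
  rewrite [X in _ --> X](_ : x = (x.1, x.2 + 0)); last first.
    by rewrite addr0 -surjective_pairing.
  apply: (@cvg_pair _ _ _ _ (nbhs x.1) (nbhs (x.2 + 0))); first exact: cvg_cst.
  by apply: cvgD; [exact: cvg_cst|exact: cvg_id].
exact: (c _ fm).
Qed.

End Laplacian.

(** * Laplacians of functions of |x - y|^2 *)

Section Radial.
Variable R : realType.
Implicit Types (x y : R * R).

Definition dist2 x y : R := (x.1 - y.1) ^+ 2 + (x.2 - y.2) ^+ 2.

Lemma is_derive_quadratic (a sg b r : R) :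
  is_derive r (1:R) (fun r : R => a + sg * (b + r) ^+ 2) (sg * (2 * (b + r))).
Proof.
have h : is_derive r (1:R) ((cst a : R -> R) + sg *: ((cst b + id) ^+ 2 : R -> R))
   (0 + sg *: ((2%:R * (b + r) ^+ 1) *: (0 + 1))).
  exact: is_deriveD.
apply: (is_derive_eq h).
by rewrite !add0r /GRing.scale /= mulr1 expr1.
Qed.

Lemma second_derivative_comp_quadratic (F F1 F2 : R -> R) (a sg b : R) :
  (forall s : R, 0 < s -> is_derive s (1:R) F (F1 s)) ->
  (forall s : R, 0 < s -> is_derive s (1:R) F1 (F2 s)) ->
  0 < a + sg * b ^+ 2 ->
  second_derivative (fun r => F (a + sg * (b + r) ^+ 2))
    (2 * sg * F1 (a + sg * b ^+ 2) + 4 * sg ^+ 2 * b ^+ 2 * F2 (a + sg * b ^+ 2)).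
Proof.
move=> dF dF1 s0.
exists (fun r => F1 (a + sg * (b + r) ^+ 2) * (sg * (2 * (b + r)))); split.
  have c : (a + sg * (b + r) ^+ 2) @[r --> (0:R)] --> a + sg * b ^+ 2.
    rewrite -[X in _ --> a + sg * X ^+ 2]addr0.
    apply: cvgD; first exact: cvg_cst.
    apply: cvgMr; rewrite !expr2.
    by apply: cvgM; apply: cvgD; (exact: cvg_cst || exact: cvg_id).
  move/cvgr_gt : c => /(_ _ s0) pos.
  near=> r.
  apply: (@is_derive1_comp _ F (fun r => a + sg * (b + r) ^+ 2)).
    by apply: dF; near: r.
  exact: is_derive_quadratic.
have h1 : is_derive (0:R) (1:R) (F1 \o (fun r => a + sg * (b + r) ^+ 2))
    (F2 (a + sg * (b + 0) ^+ 2) * (sg * (2 * (b + 0)))).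
  apply: is_derive1_comp; last exact: is_derive_quadratic.
  by apply: dF1; rewrite addr0.
have h2 : is_derive (0:R) (1:R) (fun r => sg * (2 * (b + r))) (sg *: (2 *: (0 + 1))).
  exact: (@is_deriveZ _ _ _ (fun r => 2 * (b + r)) _ _ _ _).
apply: (is_derive_eq (is_deriveM h1 h2)).
rewrite /GRing.scale /= addr0; ring.
Unshelve. all: by end_near. Qed.

(** Each axis contributes 2 sg F' and its share of 4 sg^2 r^2 F''. The factor [sg] serves both uses:
    -1 for the hyperbolic factor, positive for the potentials. *)
Lemma has_laplacian_radial (F F1 F2 : R -> R) (c sg : R) x y :
  (forall s : R, 0 < s -> is_derive s (1:R) F (F1 s)) ->
  (forall s : R, 0 < s -> is_derive s (1:R) F1 (F2 s)) ->
  0 < c + sg * dist2 x y ->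
  has_laplacian (fun z => F (c + sg * dist2 z y)) x
    (4 * sg * (F1 (c + sg * dist2 x y)
               + sg * dist2 x y * F2 (c + sg * dist2 x y))).
Proof.
move=> dF dF1 s0; rewrite /dist2 in s0 *.
eexists; eexists; split.
- apply: (@near_eq_second_derivative _
    (fun r => F (c + sg * (x.2 - y.2) ^+ 2 + sg * ((x.1 - y.1) + r) ^+ 2))).
    by near=> r; congr F; rewrite /=; ring.
  apply: (second_derivative_comp_quadratic dF dF1).
  by move: s0; congr (_ < _); ring.
- apply: (@near_eq_second_derivative _
    (fun r => F (c + sg * (x.1 - y.1) ^+ 2 + sg * ((x.2 - y.2) + r) ^+ 2))).
    by near=> r; congr F; rewrite /=; ring.
  apply: (second_derivative_comp_quadratic dF dF1).
  by move: s0; congr (_ < _); ring.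
set u := _ ^+ 2; set v := _ ^+ 2.
rewrite -!addrA -!mulrDr [v + u]addrC; ring.
Unshelve. all: by end_near. Qed.

(** F' + s F'' vanishes for F = ln, so only the shift [c] survives in the numerator: Liouville's
    equation for [sg < 0], a regularised point mass for [sg > 0]. *)
Lemma has_laplacian_ln (c sg : R) x y : 0 < c + sg * dist2 x y ->
  has_laplacian (fun z => ln (c + sg * dist2 z y)) x
    (4 * sg * c / (c + sg * dist2 x y) ^+ 2).
Proof.
move=> s0.
have dV (s : R) : 0 < s -> is_derive s (1:R) (fun s => s^-1) (- s ^- 2).
  move=> s1; have h := @is_deriveV R id s 1 1 (lt0r_neq0 s1) (is_derive_id _ _).
  by apply: (is_derive_eq h); rewrite /GRing.scale /= mulr1.
have := @has_laplacian_radial (@ln R) (fun s => s^-1) (fun s => - s ^- 2) c sg x y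
  (fun s h => is_derive1_ln h) dV s0.
set S := c + _; congr has_laplacian; rewrite /S.
by field; exact: lt0r_neq0.
Qed.

Lemma has_laplacian_powR (p c sg : R) x y : 0 < c + sg * dist2 x y ->
  has_laplacian (fun z => (c + sg * dist2 z y) `^ p) x
    (4 * sg * (p ^+ 2 * (c + sg * dist2 x y) `^ (p - 1)
      + p * (1 - p) * c * (c + sg * dist2 x y) `^ (p - 2))).
Proof.
move=> s0.
have dP2 (s : R) : 0 < s -> is_derive s (1:R) (fun s => p * s `^ (p - 1)) (p * ((p - 1) * s `^ (p - 2))).
  move=> s1; apply: is_deriveZ.
  by apply: (is_derive_eq (is_derive1_powR (p - 1) s1)); congr (_ * _ `^ _); ring.
have := @has_laplacian_radial (fun s : R => s `^ p) (fun s => p * s `^ (p - 1)) _ c sg x y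
  (fun s h => is_derive1_powR p h) dP2 s0.
set S := c + _; congr has_laplacian.
have -> : S `^ (p - 1) = S * S `^ (p - 2).
  rewrite -[in RHS](@powRr1 _ S) ?ltW// -powRrM mul1r -powRD; last first.
    by apply/implyP => _; exact: lt0r_neq0.
  by congr (_ `^ _); ring.
have -> : sg * dist2 x y = S - c by rewrite /S; ring.
ring.
Qed.

End Radial.

(** * The hyperbolic factor of a disc *)

Section HyperbolicDisc.
Variable R : realType.
Implicit Types (x y : R * R) (rho : R).

Definition sqnorm x : R := x.1 ^+ 2 + x.2 ^+ 2.

Definition disc rho : set (R * R) := [set x | sqnorm x < rho ^+ 2].

(** The factor of curvature -1, pulled back from the unit disc by x / rho. *)
Definition hyp rho x : R := (2 * rho / (rho ^+ 2 - sqnorm x)) ^+ 2.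

Lemma sqnorm_ge0 x : 0 <= sqnorm x.
Proof. by rewrite addr_ge0 ?sqr_ge0. Qed.

Lemma sqnorm_continuous : continuous sqnorm.
Proof.
move=> x; apply: cvgD; rewrite expr2; under eq_fun do rewrite expr2.
  by apply: cvgM; exact: cvg_fst.
by apply: cvgM; exact: cvg_snd.
Qed.

Lemma near_disc rho x : disc rho x -> \forall y \near x, disc rho y.
Proof. by move=> dx; move/cvgr_lt : (@sqnorm_continuous x) => /(_ _ dx). Qed.

Lemma sqnorm_le_compact rho (c : R) : 0 <= rho -> c <= rho ^+ 2 ->
  compact [set x | sqnorm x <= c].
Proof.
move=> rho0 crho.
apply: (@subclosed_compact _ _ (`[- rho, rho]%classic `*` `[- rho, rho]%classic)).
- rewrite (_ : mkset _ = sqnorm @^-1` [set` `]-oo, c]]); last first.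
    by apply/seteqP; split => x /=; rewrite in_itv.
  apply: closed_comp; last exact: interval_closed.
  by move=> x _; exact: sqnorm_continuous.
- by apply: compact_setX; exact: segment_compact.
- move=> x /= xc; rewrite /= !in_itv /= -!ler_norml.
  have h (a b : R) : a ^+ 2 + b ^+ 2 <= c -> `|a| <= rho.
    move=> abc; rewrite -(@ler_pXn2r _ 2) ?nnegrE// real_normK ?num_real//.
    by apply: le_trans crho; apply: le_trans abc; rewrite lerDl sqr_ge0.
  split; first exact: h xc.
  by apply: (@h _ x.1); rewrite addrC.
Qed.

Lemma hyp_gt0 rho x : 0 < rho -> disc rho x -> 0 < hyp rho x.
Proof. by move=> r0 dx; rewrite /hyp exprn_gt0// divr_gt0 ?mulr_gt0// subr_gt0. Qed.

Lemma ln_hyp rho x : 0 < rho -> disc rho x ->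
  ln (hyp rho x) = 2 * ln (2 * rho) - 2 * ln (rho ^+ 2 + (-1) * dist2 x 0).
Proof.
move=> r0 dx; rewrite /hyp (_ : (-1) * dist2 x 0 = - sqnorm x); last first.
  by rewrite /dist2 /sqnorm /= !subr0 mulN1r.
have D0 : 0 < rho ^+ 2 - sqnorm x by rewrite subr_gt0.
rewrite lnXn ?divr_gt0 ?mulr_gt0// ln_div ?posrE ?mulr_gt0//.
ring.
Qed.

(** Liouville's equation Delta ln h = 2 h, with ln h in its radial form from [ln_hyp]. It is what
    makes (2t + beta) h a solution. *)
Lemma has_laplacian_ln_hyp rho x : 0 < rho -> disc rho x ->
  has_laplacian (fun z => 2 * ln (2 * rho) - 2 * ln (rho ^+ 2 + (-1) * dist2 z 0)) x
    (2 * hyp rho x).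
Proof.
move=> r0 dx.
have E : (-1) * dist2 x 0 = - sqnorm x.
  by rewrite /dist2 /sqnorm /= !subr0 mulN1r.
have D0 : 0 < rho ^+ 2 - sqnorm x by rewrite subr_gt0.
have h : 0 < rho ^+ 2 + (-1) * dist2 x 0 by rewrite E.
have := has_laplacianB (has_laplacian_cst (2 * ln (2 * rho)) x)
  (has_laplacianZ 2 (has_laplacian_ln h)).
congr has_laplacian; rewrite E /hyp; field; exact: lt0r_neq0.
Qed.

(* The factor blows up at the boundary of the disc, so a function bounded above
   cannot reach a positive value of [w - tau * ln h] there. *)
Lemma interior_max rho (tau m : R) (w : R * R -> R) x0 :
  0 < rho -> 0 < tau ->
  (forall x, disc rho x -> {for x, continuous w}) ->
  (forall x, disc rho x -> w x <= m) ->
  disc rho x0 -> 0 < w x0 - tau * ln (hyp rho x0) ->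
  exists2 xs, disc rho xs &
    forall x, disc rho x ->
      w x - tau * ln (hyp rho x) <= w xs - tau * ln (hyp rho xs).
Proof.
move=> r0 t0 wc wm dx0 pos.
(* Where rho^2 - |x|^2 is at most [k1], tau ln h is at least [m], so the difference is at most 0;
   the minimum in [k] keeps [x0] in the compact set. *)
pose k1 := 2 * rho * expR (- m / (2 * tau)).
have k10 : 0 < k1 by rewrite !mulr_gt0 ?expR_gt0.
pose k := Num.min k1 (rho ^+ 2 - sqnorm x0).
have k0 : 0 < k by rewrite lt_min k10 subr_gt0.
pose K := [set x | sqnorm x <= rho ^+ 2 - k].
have Kdisc x : K x -> disc rho x.
  by rewrite /K /= => /le_lt_trans; apply; rewrite ltrBlDr ltrDl.
have Kx0 : K x0.
  by rewrite /K /= lerBrDr -lerBrDl ge_min lexx orbT.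
have cK : compact K.
  by apply: (sqnorm_le_compact (ltW r0)); rewrite lerBlDr lerDl ltW.
have cont x : disc rho x -> {for x, continuous (fun x => w x - tau * ln (hyp rho x))}.
  move=> dx; apply: cvgB; first exact: wc.
  apply: cvgMr; rewrite /= ln_hyp//.
  apply: cvg_trans.
    apply: near_eq_cvg.
    near=> y; rewrite [in RHS]ln_hyp//.
    by near: y; exact: near_disc.
  apply: cvgB; first exact: cvg_cst.
  apply: cvgMr.
  apply: (@continuous_comp _ _ _ (fun z => rho ^+ 2 + (-1) * dist2 z 0) (@ln R)).
    apply: cvgD; first exact: cvg_cst.
    apply: cvgMr; rewrite /dist2 /= !subr0.
    under eq_fun do rewrite !subr0.
    exact: sqnorm_continuous.
  apply: continuous_ln.
  by rewrite /dist2 /= !subr0 mulN1r subr_gt0.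
have [||xs] := @compact_EVT_max _ R (fun x => w x - tau * ln (hyp rho x)) K _ cK.
- by exists x0.
- apply: continuous_in_subspaceT => x; rewrite inE => /Kdisc; exact: cont.
rewrite inE => Kxs xsmax.
exists xs; first exact: Kdisc.
move=> x dx; have [Kx|] := boolP (x \in K); first exact: xsmax.
rewrite notin_setE /K /= => /negP; rewrite -ltNge => Kx.
have xsx0 := xsmax x0 (mem_set Kx0).
apply: le_trans (le_trans (ltW pos) xsx0).
rewrite subr_le0; apply: (le_trans (wm x dx)).
have D0 : 0 < rho ^+ 2 - sqnorm x by rewrite subr_gt0.
have Dk : rho ^+ 2 - sqnorm x <= k1.
  have : k <= k1 by rewrite ge_min lexx.
  by move: Kx; lra.
have hle : expR (m / (2 * tau)) <= 2 * rho / (rho ^+ 2 - sqnorm x).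
  rewrite ler_pdivlMr// -ler_pdivlMl ?expR_gt0// -expRN mulrC -mulNr.
  exact: Dk.
rewrite /hyp lnXn; last exact: lt_le_trans (expR_gt0 _) hle.
have : m / (2 * tau) <= ln (2 * rho / (rho ^+ 2 - sqnorm x)).
  by rewrite -(expRK (m / (2 * tau))) ler_ln ?posrE ?expR_gt0// (lt_le_trans (expR_gt0 _) hle).
rewrite ler_pdivrMr ?mulr_gt0// -mulr_natl => h; apply: (le_trans h); lra.
Unshelve. all: by end_near. Qed.

End HyperbolicDisc.

(** * Flows and their Aronson-Benilan envelope *)

Section Flow.
Variable R : realType.
Implicit Types (x y : R * R) (rho S t s : R) (u Lam : R * R -> R -> R).

(** What the maximum principles take from a solution on a smaller cylinder; [Lam] is Delta ln u. The
    last clause is a backward Euler inequality: the increment is controlled by the Laplacian at the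
    later time, with a step size uniform in space and time. *)
Definition regular_flow rho S u Lam : Prop :=
  [/\ forall x t, disc rho x -> 0 <= t <= S -> 0 < u x t,
      exists M, forall x t, disc rho x -> 0 <= t <= S -> u x t <= M /\ Lam x t <= M,
      forall x t, disc rho x -> 0 <= t <= S ->
        has_laplacian (fun y => ln (u y t)) x (Lam x t),
      forall x t, disc rho x -> 0 <= t <= S -> {for x, continuous (u ^~ t)} &
      forall w, 0 < w -> exists2 d, 0 < d & forall x s s', disc rho x ->
        0 <= s' -> s' < s -> s <= S -> s - s' <= d ->
        u x s - u x s' <= (s - s') * (Lam x s + w)].

Lemma regular_flow_shift rho S u Lam a : 0 <= a -> regular_flow rho S u Lam ->
  regular_flow rho (S - a) (fun x t => u x (a + t)) (fun x t => Lam x (a + t)).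
Proof.
move=> a0 [h1 [M h2] h3 h4 h5].
have b t : 0 <= t <= S - a -> 0 <= a + t <= S by move=> /andP[? ?]; apply/andP; split; lra.
split.
- by move=> x t dx /b; exact: h1.
- by exists M => x t dx /b; exact: h2.
- by move=> x t dx /b; exact: h3.
- by move=> x t dx /b; exact: h4.
move=> w /h5[d d0 hd]; exists d => // x s s' dx s0 ss sS sd.
have -> : s - s' = (a + s) - (a + s') by ring.
by apply: hd => //; lra.
Qed.

(** Lets additive errors be absorbed into multiples of h. *)
Lemma hyp_ge1 rho x : 0 < rho -> rho <= 1 -> disc rho x -> 1 <= hyp rho x.
Proof.
move=> r0 r1 dx; have x0 := sqnorm_ge0 x; rewrite /hyp exprn_ege1//.
rewrite ler_pdivlMr ?subr_gt0// mul1r.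
have : rho ^+ 2 <= rho by rewrite expr2 -[leRHS]mulr1 ler_pM2l.
by move: x0; lra.
Qed.

(** One Euler step handles [s <= d]; beyond [d] the global bound is itself at most a multiple of
    [s]. The linear bound ties the smallest grid time to the initial data. *)
Lemma flow_growth rho S u Lam : regular_flow rho S u Lam ->
  exists2 M, 0 <= M & forall x s, disc rho x -> 0 <= s <= S ->
    u x s <= M /\ u x s <= u x 0 + M * s.
Proof.
move=> [h1 [M h2] h3 h4 h5].
have [d d0 hd] := h5 1 ltr01.
pose M' := Num.max 0 M.
have M'0 : 0 <= M' by rewrite le_max lexx.
have MM' : M <= M' by rewrite le_max lexx orbT.
exists (M' / d + M' + 1); first by rewrite !addr_ge0// divr_ge0// ltW.
move=> x s dx /andP[s0 sS].
have S0 := le_trans s0 sS.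
have [uM LM] := h2 x s dx ltac:(by apply/andP).
have Md0 : 0 <= M' / d by rewrite divr_ge0// ltW.
split; first by lra.
have u0 : 0 < u x 0 by apply: h1 => //; apply/andP; split; lra.
case: (ltgtP 0 s) s0 => // [s0 _|<-]; last by rewrite mulr0 addr0.
have [sd|ds] := leP s d.
  have := hd x s 0 dx (lexx _) s0 sS; rewrite subr0 => /(_ sd).
  rewrite lerBlDl => /le_trans; apply; rewrite lerD2l mulrC ler_pM2r//; lra.
have : M' <= M' / d * s.
  by rewrite -mulrA [d^-1 * s]mulrC mulrA ler_pdivlMr// ler_wpM2l// ltW.
have : 0 <= (M' + 1) * s by rewrite mulr_ge0 ?addr_ge0// ltW.
have -> : (M' / d + M' + 1) * s = M' / d * s + (M' + 1) * s by ring.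
move: uM MM'; lra.
Qed.

End Flow.

(* A discrete Aronson-Benilan envelope: [envelope k] dominates [u (r k)] and
   [envelope k / r k] is nondecreasing in [k], whatever [u] does at the boundary. *)
Section Envelope.
Variables (R : realType) (rho S t q M : R) (u Lam : R * R -> R -> R).
Hypotheses (t0 : 0 < t) (tS : t <= S)
  (q1 : 1 < q) (fl : regular_flow rho S u Lam) (M0 : 0 <= M)
  (growth : forall x s, disc rho x -> 0 <= s <= S ->
    u x s <= M /\ u x s <= u x 0 + M * s).

Let r k := t / q ^+ k.

Fixpoint envelope k x : R :=
  if k is k'.+1 then Num.max (u x (r k)) (envelope k' x / q) else u x (r 0).

Let q0 : 0 < q. Proof. exact: lt_trans q1. Qed.

Let r_gt0 k : 0 < r k. Proof. by rewrite divr_gt0 ?exprn_gt0. Qed.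

Let r_S k : r k.+1 = r k / q.
Proof. by rewrite /r exprS invfM mulrA mulrAC. Qed.

Let r_lt k : r k.+1 < r k.
Proof. by rewrite r_S ltr_pdivrMr// ltr_pMr. Qed.

Let r_le k : r k <= t.
Proof. by elim: k => [|k /(le_trans (ltW (r_lt k)))//]; rewrite /r expr0 divr1. Qed.

Let r_in k : 0 <= r k <= S.
Proof. by apply/andP; split; [exact/ltW/r_gt0|exact: le_trans (r_le k) tS]. Qed.

Lemma envelope_ge k x : u x t * (r k / t) <= envelope k x.
Proof.
elim: k => [|k IH] /=.
  by rewrite /r expr0 divr1 divff ?mulr1// lt0r_neq0.
rewrite le_max; apply/orP; right.
by rewrite r_S mulrAC mulrA ler_pM2r ?invr_gt0.
Qed.

Lemma envelope_le k x : disc rho x -> envelope k x <= u x 0 + M * r k /\ envelope k x <= M.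
Proof.
move=> dx; have [u_gt0 _ _ _ _] := fl.
have u00 : 0 < u x 0 by apply: u_gt0 => //; rewrite lexx ltW// (lt_le_trans t0).
elim: k => [|k [IH1 IH2]] /=; first by have [] := growth dx (r_in 0).
rewrite !ge_max; have [-> ->] := growth dx (r_in k.+1); split; rewrite andTb.
  (* Division by [q] turns [M * r k] into [M * r k.+1] and only lowers [u x 0], which is
     positive. *)
  rewrite ler_pdivrMr// mulrDl -mulrA r_S divfK ?lt0r_neq0//.
  by apply: (le_trans IH1); rewrite lerD2r ler_peMr ?ltW.
by rewrite ler_pdivrMr// (le_trans IH2)// ler_peMr// ltW.
Qed.

Lemma envelope_gt0 k x : disc rho x -> 0 < envelope k x.
Proof.
move=> dx; apply: (lt_le_trans _ (envelope_ge k x)).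
have [u_gt0 _ _ _ _] := fl.
have ut : 0 < u x t by apply: u_gt0 => //; apply/andP; split => //; exact: ltW.
by rewrite mulr_gt0// divr_gt0// r_gt0.
Qed.

Lemma envelope_continuous k x : disc rho x -> {for x, continuous (envelope k)}.
Proof.
have [_ _ _ uc _] := fl.
move=> dx; elim: k => [|k IH] /=; first exact: uc.
apply: (@continuous_max _ _ (u ^~ (r k.+1)) (fun x => envelope k x / q)).
  exact: uc.
by apply: cvgMl.
Qed.

(** Produces the test function of the viscosity argument: a multiple of one time slice of [u] lies
    below the envelope and meets it at [x]. The last clause lets a decrement of the envelope be
    bounded by one of [u]; it survives the induction because both of its sides are divided by
    [q]. *)
Lemma envelope_touch k x : exists ic : nat * R,
  [/\ 0 < ic.2, ic.2 * r ic.1 = r k,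
      envelope k x = ic.2 * u x (r ic.1),
      forall y, ic.2 * u y (r ic.1) <= envelope k y &
      ic.2 * u x (r ic.1.+1) <= envelope k.+1 x].
Proof.
elim: k => [|k [[i c] /= [c0 cr E le le1]]].
  exists (0%N, 1); split; rewrite /= ?mul1r ?ltr01//.
  - by move=> y; rewrite mul1r.
  - by rewrite le_max lexx.
move: le1; have [h _|h le1] := leP (envelope k x / q) (u x (r k.+1)).
  exists (k.+1, 1); split; rewrite /= ?mul1r ?ltr01//.
  - by move=> y; rewrite mul1r le_max lexx.
  - by rewrite le_max lexx.
exists (i, c / q); split; rewrite /= ?divr_gt0//.
- by rewrite mulrAC cr r_S.
- by rewrite E mulrAC.
- by move=> y; rewrite le_max mulrAC ler_pM2r ?invr_gt0// (le y) orbT.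
- by rewrite le_max mulrAC ler_pM2r ?invr_gt0// le1 orbT.
Qed.

(** Replacing u(r) by c u(r / c) preserves the equation: ln u changes by a constant, and the time
    step and the increment are both multiplied by c. Hence the Euler inequality passes from [u] to
    the envelope at a touching point. *)
Lemma envelope_decr k x w ic : disc rho x ->
  (forall x s s', disc rho x -> 0 <= s' -> s' < s -> s <= S -> s - s' <= t * (q - 1) ->
     u x s - u x s' <= (s - s') * (Lam x s + w)) ->
  0 < ic.2 -> ic.2 * r ic.1 = r k -> envelope k x = ic.2 * u x (r ic.1) ->
  ic.2 * u x (r ic.1.+1) <= envelope k.+1 x ->
  envelope k x - envelope k.+1 x <= (r k - r k.+1) * (Lam x (r ic.1) + w).
Proof.
case: ic => i c /= dx step c0 cr E le1.
have -> : r k - r k.+1 = c * (r i - r i.+1).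
  by rewrite mulrBr cr (r_S k) (r_S i) mulrA cr.
apply: (@le_trans _ _ (c * (u x (r i) - u x (r i.+1)))).
  by rewrite mulrBr; apply: lerB => //; rewrite E.
rewrite -mulrA ler_pM2l//; apply: step => //.
- by rewrite ltW.
- by have /andP[] := r_in i.
- have -> : r i - r i.+1 = r i.+1 * (q - 1).
    by rewrite r_S mulrBr mulr1 divfK ?lt0r_neq0.
  by rewrite ler_pM2r ?subr_gt0.
Qed.

End Envelope.

(** * The smoothing estimate *)

Section Smoothing.
Variable R : realType.
Implicit Types (x y : R * R) (rho S t : R) (u Lam : R * R -> R -> R).

Lemma telescope_decr (V : zmodType) (f : nat -> V) m n : (m <= n)%N ->
  \sum_(m <= k < n) (f k - f k.+1) = f m - f n.
Proof.
move=> mn; rewrite (@telescope_sumr_eq _ m n (fun k => - f k))//.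
  by rewrite opprK addrC.
by move=> k _; rewrite opprK addrC.
Qed.

Lemma ln_le_subr1 (z : R) : 0 < z -> ln z <= z - 1.
Proof. by move=> z0; have := expR_ge1Dx (ln z); rewrite lnK// lerBrDl. Qed.

(* The primitive [s ln (s / t) - s] gives [int_0^t ln (s / t) ds = - t]. *)
Lemma sum_ln_ratio_ge t (r : nat -> R) n : 0 < t -> r 0%N = t ->
  (forall k, 0 < r k) -> (forall k, r k <= t) ->
  - t <= \sum_(0 <= k < n) (r k - r k.+1) * ln (r k / t).
Proof.
move=> t0 rt r0 rle.
pose H k := r k * ln (r k / t) - r k.
have step k : H k - H k.+1 <= (r k - r k.+1) * ln (r k / t).
  have : ln (r k / t) - ln (r k.+1 / t) <= r k / r k.+1 - 1.
    rewrite -ln_div ?posrE ?divr_gt0//.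
    have -> : r k / t / (r k.+1 / t) = r k / r k.+1.
      by field; rewrite !lt0r_neq0.
    by apply: ln_le_subr1; rewrite divr_gt0.
  rewrite -(ler_pM2l (r0 k.+1)) [leRHS]mulrBr mulrCA mulfV ?lt0r_neq0// !mulr1.
  rewrite /H; lra.
apply: (@le_trans _ _ (\sum_(0 <= k < n) (H k - H k.+1))); last first.
  by apply: ler_sum => k _; exact: step.
rewrite telescope_decr// /H rt divff ?lt0r_neq0// ln1 mulr0 sub0r opprB.
rewrite lerDl subr_ge0.
rewrite -[leRHS]mulr1 ler_pM2l//.
by apply: (@le_trans _ _ 0) => //; rewrite ln_le0// ler_pdivrMr// mul1r.
Qed.

(** If the bound fails at [x0], the integrated quantity [E] below is forced to be positive there,
    while the maximum principle shows [E <= 0] by induction from the earliest grid time [r n] up to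
    [t]. *)
Lemma smoothing rho S u Lam (psi lpsi : R * R -> R) (alpha beta : R) t x0 :
  0 < rho -> rho <= 1 -> regular_flow rho S u Lam -> 0 < t -> t <= S ->
  0 <= alpha -> alpha < beta ->
  (forall x, disc rho x -> {for x, continuous psi}) ->
  (forall x, disc rho x -> 0 <= psi x) ->
  (forall x, disc rho x -> has_laplacian psi x (lpsi x)) ->
  (forall x, disc rho x -> u x 0 + lpsi x <= alpha * hyp rho x) ->
  disc rho x0 ->
  u x0 t <= expR 1 * (2 * t + beta) * hyp rho x0 * expR (psi x0 / t).
Proof.
move=> rho0 rho1 fl t0 tS al0 alb psic psi0 psiL u0psi dx0.
have [M M0 growth] := flow_growth fl.
have [u_gt0 [M1 bnd] uL uc step] := fl.
have be0 : 0 < beta by exact: le_lt_trans alb.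
(* Half of this slack pays for starting the grid at [r n] rather than 0, the other half for the
   Euler errors, each at rate [sl / (2 * t)]. *)
pose sl := beta - alpha; have sl0 : 0 < sl by rewrite subr_gt0.
have tin : 0 <= t <= S by apply/andP; split => //; exact: ltW.
have h0 := hyp_gt0 rho0 dx0.
have b0 : 0 < 2 * t + beta by rewrite addr_gt0// mulr_gt0.
have ut0 : 0 < u x0 t by exact: u_gt0.
have e0 (z : R) : 0 < expR z := expR_gt0 z.
have bh0 : 0 < (2 * t + beta) * hyp rho x0 by exact: mulr_gt0.
have ebh0 : 0 < expR 1 * ((2 * t + beta) * hyp rho x0) by exact: mulr_gt0.
rewrite -[_ * _ * hyp _ _]mulrA -ler_ln ?posrE//; last exact: mulr_gt0.
rewrite lnM ?posrE// (lnM (e0 1) bh0) 2!expRK.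
set Y := ln ((2 * t + beta) * hyp rho x0).
rewrite leNgt; apply/negP => contra.
pose X := ln (u x0 t) - Y.
have X0 : psi x0 / t + 1 < X by rewrite /X; move: contra; lra.
have p0 : 0 <= psi x0 / t by rewrite divr_ge0 ?psi0// ltW.
have Xp : 0 < X by move: p0 X0; lra.
have M1p : 0 < M + 1 by rewrite ltr_wpDl.
(* Bound for the earliest grid time. The first entry keeps half of the excess of [t * X] over
   [psi x0 + t] after [r n * X] is lost; the second gives [M * r n <= sl / 2]. *)
pose sg := Num.min (t * (X - (psi x0 / t + 1)) / (2 * X)) (sl / (2 * (M + 1))).
have sg0 : 0 < sg.
  rewrite lt_min; apply/andP; split; apply: divr_gt0 => //; apply: mulr_gt0 => //.
  by rewrite subr_gt0.
have w0 : 0 < sl / (2 * t) by rewrite divr_gt0 ?mulr_gt0.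
have [d d0 hd] := step _ w0.
(* Every grid step then has length [r k.+1 * (q - 1)], at most [d]. *)
pose q := 1 + d / t.
have q1 : 1 < q by rewrite ltrDl divr_gt0.
have qd : t * (q - 1) = d by rewrite /q addrC addKr mulrCA mulfV ?mulr1// lt0r_neq0.
have [n rn] : exists n, t / q ^+ n < sg.
  have : geometric t q^-1 k @[k --> \oo] --> (0 : R).
    apply: cvg_geometric; rewrite gtr0_norm ?invr_gt0 ?(lt_trans _ q1)//.
    by rewrite invf_lt1// (lt_trans _ q1).
  move/cvgr_lt => /(_ _ sg0) [n _ /(_ n (leqnn n))].
  by rewrite /geometric /= exprVn => ?; exists n.
pose r k := t / q ^+ k.
have q0 : 0 < q by exact: lt_trans q1.
have r_gt0 k : 0 < r k by rewrite divr_gt0 ?exprn_gt0.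
have r_S k : r k.+1 = r k / q by rewrite /r exprS invfM mulrA mulrAC.
have r_lt k : r k.+1 < r k by rewrite r_S ltr_pdivrMr// ltr_pMr.
have r_anti m k : (m <= k)%N -> r k <= r m.
  by move=> mk; apply: (@homo_leq _ r (fun a b => b <= a)) mk => //;
    [move=> a b c ba cb; exact: le_trans cb ba|move=> i; exact: ltW].
have r00 : r 0%N = t by rewrite /r expr0 divr1.
have r_le k : r k <= t by rewrite -r00; exact: r_anti.
have r_in k : 0 <= r k <= S by rewrite (le_trans (r_le k) tS) ltW.
pose v := envelope t q u.
pose D k := r k - r k.+1.
have D0 k : 0 < D k by rewrite subr_gt0.
(* [E m] discretizes the integral of ln (v / ((2s + beta) h)) over [r n, r m], minus psi. *)
pose w m x := \sum_(m <= k < n) D k * (ln (v k x) - ln (2 * r k + beta)) - psi x.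
pose E m x := w m x - (r m - r n) * ln (hyp rho x).
have v_gt0 k x : disc rho x -> 0 < v k x .
  exact: (envelope_gt0 t0 tS q1 fl).
have claim j x : (j <= n)%N -> disc rho x -> E (n - j)%N x <= 0.
  elim: j x => [|j IH] x jn dx.
    by rewrite /E /w subn0 big_geq// sub0r subrr mul0r subr0 oppr_le0 psi0.
  have [m [mn Em]] : exists m, (m < n)%N /\ (n - j.+1)%N = m /\ (n - j)%N = m.+1.
    exists (n - j.+1)%N; split; last by rewrite subnSK.
    by rewrite ltn_subrL/= (leq_ltn_trans _ jn).
  have [-> Em1] := Em; have IHm y : disc rho y -> E m.+1 y <= 0.
    by move=> dy; rewrite -Em1 IH// ltnW.
  rewrite leNgt; apply/negP => pos.
  have tau0 : 0 < r m - r n.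
    by rewrite subr_gt0 (le_lt_trans _ (r_lt m))// r_anti.
  have wE y : w m y = D m * (ln (v m y) - ln (2 * r m + beta)) + w m.+1 y.
    by rewrite /w big_ltn// addrA.
  have wcont y : disc rho y -> {for y, continuous (w m)}.
    move=> dy; rewrite /w; apply: cvgB; last exact: psic.
    apply: cvg_big => [|k _]; first exact: add_continuous.
    apply: cvgMr; apply: cvgB; last exact: cvg_cst.
    apply: (@continuous_comp _ _ _ (v k) (@ln R)).
      exact: (envelope_continuous t0 tS q1 fl dy).
    exact/continuous_ln/v_gt0.
  pose mm := \sum_(m <= k < n) D k * (ln M - ln (2 * r k + beta)).
  have wle y : disc rho y -> w m y <= mm.
    move=> dy; rewrite /w lerBlDr.
    apply: ler_wpDr; first exact: psi0.
    apply: ler_sum => k _; rewrite ler_pM2l// lerD2r.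
    have [_ vM] := envelope_le t0 tS q1 fl M0 growth k dy.
    by rewrite ler_ln ?posrE ?v_gt0// (lt_le_trans (v_gt0 k _ dy)).
  have [xs dxs xsmax] := interior_max rho0 tau0 wcont wle dx pos.
  have Epos := lt_le_trans pos (xsmax x dx).
  have touch k : exists p : nat * R, [/\ 0 < p.2, p.2 * r p.1 = r k,
      v k xs = p.2 * u xs (r p.1), forall y, p.2 * u y (r p.1) <= v k y &
      p.2 * u xs (r p.1.+1) <= v k.+1 xs] by exact: envelope_touch.
  have [ic icP] := choice touch.
  (* The envelope is only a maximum, so each [v k] is replaced by its touching slice. The resulting
     [F] lies below [E m] and agrees with it at [xs], so it too is maximal there and the Laplacian
     test applies. *)
  pose phi k y := ln (ic k).2 + ln (u y (r (ic k).1)).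
  have phile k y : disc rho y -> phi k y <= ln (v k y).
    move=> dy; have [c0 _ _ le _] := icP k.
    have uy0 : 0 < u y (r (ic k).1) by exact: u_gt0.
    by rewrite /phi -lnM ?posrE// ler_ln ?posrE ?v_gt0 ?mulr_gt0//; exact: le.
  have phieq k : phi k xs = ln (v k xs).
    have [c0 _ e _ _] := icP k.
    have uy0 : 0 < u xs (r (ic k).1) by exact: u_gt0.
    by rewrite /phi -lnM ?posrE// e.
  pose F y := \sum_(m <= k < n) D k * (phi k y - ln (2 * r k + beta)) - psi y
     - (r m - r n) * (2 * ln (2 * rho) - 2 * ln (rho ^+ 2 + (-1) * dist2 y 0)).
  have FL : has_laplacian F xs (\sum_(m <= k < n) D k * (0 + Lam xs (r (ic k).1) - 0)
     - lpsi xs - (r m - r n) * (2 * hyp rho xs)).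
    apply: has_laplacianB; last exact/has_laplacianZ/has_laplacian_ln_hyp.
    apply: has_laplacianB; last exact: psiL.
    apply: has_laplacian_sum => k; apply: has_laplacianZ.
    apply: has_laplacianB; last exact: has_laplacian_cst.
    by apply: has_laplacianD; [exact: has_laplacian_cst|exact: uL].
  have /(has_laplacian_max FL) Lle : \forall y \near xs, F y <= F xs.
    near=> y.
    have dy : disc rho y by near: y; exact: near_disc.
    have := xsmax y dy; rewrite !ln_hyp// -/(F xs).
    have -> : w m xs = \sum_(m <= k < n) D k * (phi k xs - ln (2 * r k + beta)) - psi xs.
      by rewrite /w; congr (_ - _); apply: eq_bigr => k _; rewrite phieq.
    apply: le_trans; rewrite /F lerD2r lerD2r.
    by apply: ler_sum => k _; rewrite ler_pM2l// lerD2r phile.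
  have vdecr k : v k xs - v k.+1 xs <= D k * (Lam xs (r (ic k).1) + sl / (2 * t)).
    have [c0 cr e _ le1] := icP k.
    apply: (envelope_decr t0 tS q1 dxs _ c0 cr e le1).
    by rewrite qd => *; exact: hd.
  have : v m xs - v n xs <= \sum_(m <= k < n) D k * (Lam xs (r (ic k).1) + sl / (2 * t)).
    by rewrite -(telescope_decr (fun k => v k xs)) ?(ltnW mn)//; exact: ler_sum.
  under eq_bigr do rewrite mulrDr.
  rewrite big_split /= -mulr_suml (telescope_decr r) ?(ltnW mn)// => vmn.
  have {}vmn : v m xs - v n xs <= lpsi xs + (r m - r n) * (2 * hyp rho xs) + (r m - r n) * (sl / (2 * t)).
    apply: (le_trans vmn); rewrite lerD2r.
    move: Lle; rewrite (eq_bigr (fun k => D k * Lam xs (r (ic k).1))); first lra.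
    by move=> k _; rewrite add0r subr0.
  have hx1 := hyp_ge1 rho0 rho1 dxs.
  have vn : v n xs <= u xs 0 + M * r n.
    by have [] := envelope_le t0 tS q1 fl M0 growth n dxs.
  have Mr : M * r n <= sl / 2.
    have : r n <= sl / (2 * (M + 1)).
      by rewrite (le_trans (ltW rn))// ge_min lexx orbT.
    rewrite ler_pdivlMr ?mulr_gt0 ?ltr_wpDl// => h.
    have := ltW (r_gt0 n); lra.
  have wt : (r m - r n) * (sl / (2 * t)) <= sl / 2.
    rewrite invfM [sl * _]mulrA mulrA ler_pdivrMr// [leLHS]mulrC ler_pM2l ?divr_gt0//.
    by have := r_le m; have := ltW (r_gt0 n); lra.
  (* The Laplacian test bounds [v m - v n] by [lpsi] and 2 (r m - r n) h; [lpsi] combines with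
     [u xs 0] into [alpha * hyp], and the errors use up [sl]. *)
  have vm : v m xs <= (2 * r m + beta) * hyp rho xs.
    have := u0psi xs dxs => u0.
    have slh : sl <= sl * hyp rho xs by rewrite ler_peMr// ltW.
    have rnh : 0 <= r n * hyp rho xs by rewrite mulr_ge0 ?(le_trans ler01 hx1)// ltW.
    have -> : beta = alpha + sl by rewrite /sl; ring.
    move: vmn vn Mr wt u0 slh rnh; lra.
  have brm : 0 < 2 * r m + beta by rewrite addr_gt0// mulr_gt0.
  have hxs := hyp_gt0 rho0 dxs.
  (* So the term [k = m] adds nothing positive: [E m xs <= E m.+1 xs <= 0], against positivity at
     the maximum. *)
  have : ln (v m xs) - ln (2 * r m + beta) - ln (hyp rho xs) <= 0.
    have vm0 := v_gt0 m xs dxs; have bh := mulr_gt0 brm hxs.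
    by rewrite -addrA -opprD -lnM ?posrE// subr_le0 ler_ln ?posrE.
  rewrite -(pmulr_rle0 _ (D0 m)) => hm.
  have := IHm xs dxs; move: Epos; rewrite /E wE; rewrite /D in hm *.
  move: hm; lra.
have := claim n x0 (leqnn n) dx0; rewrite subnn /E /w r00.
(* The envelope bound [v k >= u t * (r k / t)] costs the integral of ln (s / t), namely [- t]; after
   division by [t] this is the factor [expR 1]. *)
have sumlow : (t - r n) * (ln (u x0 t) - ln (2 * t + beta)) - t <=
    \sum_(0 <= k < n) D k * (ln (v k x0) - ln (2 * r k + beta)).
  have := sum_ln_ratio_ge n t0 r00 r_gt0 r_le => sl1.
  apply: (@le_trans _ _ (\sum_(0 <= k < n) (D k * (ln (u x0 t) - ln (2 * t + beta)) + D k * ln (r k / t)))).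
    rewrite big_split /= -mulr_suml (telescope_decr r)// r00 lerD2l.
    exact: sl1.
  apply: ler_sum => k _; rewrite -mulrDr ler_pM2l//.
  have : ln (2 * r k + beta) <= ln (2 * t + beta).
    have rb : 0 < 2 * r k + beta by rewrite addr_gt0// mulr_gt0.
    by rewrite ler_ln ?posrE// lerD2r ler_pM2l.
  have : ln (u x0 t) + ln (r k / t) <= ln (v k x0).
    have rt : 0 < r k / t by exact: divr_gt0.
    have vk := v_gt0 k x0 dx0; have urt := mulr_gt0 ut0 rt.
    by rewrite -lnM ?posrE// ler_ln ?posrE//; exact: envelope_ge.
  lra.
move=> fin.
have YE : Y = ln (2 * t + beta) + ln (hyp rho x0) by rewrite /Y lnM ?posrE.
have key : (t - r n) * X <= psi x0 + t by rewrite /X YE; move: fin sumlow; lra.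
have : r n <= t * (X - (psi x0 / t + 1)) / (2 * X).
  by rewrite (le_trans (ltW rn))// ge_min lexx.
rewrite ler_pdivlMr ?mulr_gt0// => h.
have e : t * (X - (psi x0 / t + 1)) = t * X - (psi x0 + t).
  by field; rewrite lt0r_neq0.
have : 0 < t * (X - (psi x0 / t + 1)) by rewrite mulr_gt0 ?subr_gt0.
move: key h; rewrite e; lra.
Unshelve. all: by end_near. Qed.

End Smoothing.

(** * Comparison with the solution (2t + beta) h *)

Section Comparison.
Variable R : realType.
Implicit Types (x y : R * R) (rho S t : R) (u Lam : R * R -> R -> R).

(** Induction along a uniform time grid. At an interior maximum of ln u - ln h the Laplacian of ln u
    is at most 2 h, so one Euler step raises the bound by (2 + w) h per unit of time. *)
Lemma comparison rho S u Lam (alpha beta : R) t x0 :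
  0 < rho -> rho <= 1 -> regular_flow rho S u Lam -> 0 <= t <= S ->
  0 < alpha -> alpha < beta ->
  (forall x, disc rho x -> u x 0 <= alpha * hyp rho x) ->
  disc rho x0 ->
  u x0 t <= (2 * t + beta) * hyp rho x0.
Proof.
move=> rho0 rho1 [u_gt0 [M bnd] uL uc step] /andP[t0 tS] al0 alb u0 dx0.
have hx0 := hyp_gt0 rho0 dx0.
case: (ltgtP 0 t) t0 => // [t0 _|<- _]; last first.
  by apply: (le_trans (u0 _ dx0)); rewrite mulr0 add0r ler_pM2r// ltW.
(* Chosen so that the accumulated error [w * t] is exactly [beta - alpha]. *)
pose w := (beta - alpha) / t.
have w0 : 0 < w by rewrite divr_gt0// subr_gt0.
have [d d0 hd] := step _ w0.
pose N := (Num.trunc (t / d)).+1.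
have N0 : 0 < N%:R :> R by rewrite ltr0n.
have tN : t / N%:R <= d.
  rewrite ler_pdivrMr// mulrC -ler_pdivrMr// ltW//.
  by rewrite truncnS_gt.
pose s k : R := t / N%:R * k%:R.
have s0 k : 0 <= s k by rewrite mulr_ge0// divr_ge0// ltW.
have sS k : s k.+1 = s k + t / N%:R by rewrite /s -natr1 mulrDr mulr1.
have st k : (k <= N)%N -> s k <= S.
  move=> kN; apply: le_trans tS; rewrite /s mulrAC ler_pdivrMr// ler_pM2l//.
  by rewrite ler_nat.
have key k : (k <= N)%N -> forall x, disc rho x ->
    u x (s k) <= ((2 + w) * s k + alpha) * hyp rho x.
  elim: k => [_ x dx|k IH kN x dx].
    by rewrite /s mulr0 mulr0 add0r u0.
  have sin : 0 <= s k.+1 <= S by rewrite s0 st.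
  set K := _ + alpha.
  have K0 : 0 < K by rewrite ltr_wpDl// mulr_ge0// addr_ge0// ltW.
  have hx := hyp_gt0 rho0 dx.
  have ux := u_gt0 x _ dx sin.
  rewrite leNgt; apply/negP => contra.
  have pos : 0 < ln (u x (s k.+1)) - ln K - 1 * ln (hyp rho x).
    rewrite mul1r -addrA -opprD -lnM ?posrE// subr_gt0 ltr_ln ?posrE//.
    exact: mulr_gt0.
  have wc y : disc rho y -> {for y, continuous (fun y => ln (u y (s k.+1)) - ln K)}.
    move=> dy; apply: cvgB; last exact: cvg_cst.
    apply: (@continuous_comp _ _ _ (u ^~ (s k.+1)) (@ln R)); first exact: uc.
    exact/continuous_ln/u_gt0.
  have wM y : disc rho y -> ln (u y (s k.+1)) - ln K <= ln M - ln K.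
    move=> dy; have uy := u_gt0 y _ dy sin.
    have [uM _] := bnd y _ dy sin.
    by rewrite lerD2r ler_ln ?posrE// (lt_le_trans uy).
  have [xs dxs xsmax] := interior_max rho0 ltr01 wc wM dx pos.
  have Epos := lt_le_trans pos (xsmax x dx).
  have FL := has_laplacianB (uL xs _ dxs sin) (has_laplacian_ln_hyp rho0 dxs).
  have /(has_laplacian_max FL) : \forall y \near xs,
    ln (u y (s k.+1)) - (2 * ln (2 * rho) - 2 * ln (rho ^+ 2 + (-1) * dist2 y 0)) <=
    ln (u xs (s k.+1)) - (2 * ln (2 * rho) - 2 * ln (rho ^+ 2 + (-1) * dist2 xs 0)).
    near=> y; have dy : disc rho y by near: y; exact: near_disc.
    by have := xsmax y dy; rewrite !mul1r -!ln_hyp//; lra.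
  rewrite subr_le0 => Lh.
  have hxs := hyp_gt0 rho0 dxs; have hx1 := hyp_ge1 rho0 rho1 dxs.
  have uxs := u_gt0 xs _ dxs sin.
  have tN0 : 0 < t / N%:R by exact: divr_gt0.
  have : u xs (s k.+1) - u xs (s k) <= (s k.+1 - s k) * (Lam xs (s k.+1) + w).
    apply: hd => //; rewrite ?sS ?ltrDl//; first by rewrite -sS st.
    by rewrite addrAC subrr add0r.
  rewrite [s k.+1 - _](_ : _ = t / N%:R); last by rewrite sS; ring.
  move=> incr; have IHk := IH (ltnW kN) xs dxs.
  have : t / N%:R * (Lam xs (s k.+1) + w) <= t / N%:R * ((2 + w) * hyp rho xs).
    rewrite ler_pM2l// mulrDl lerD// ler_peMr// ltW//.
  have KE : K = (2 + w) * s k + alpha + (2 + w) * (t / N%:R) by rewrite /K sS; ring.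
  move=> h.
  have : u xs (s k.+1) <= K * hyp rho xs.
    by rewrite KE; move: IHk incr h; lra.
  rewrite -ler_ln ?posrE//; last exact: mulr_gt0.
  rewrite lnM ?posrE// => hh.
  by move: Epos; rewrite mul1r; lra.
have := key N (leqnn N) x0 dx0.
have -> : s N = t by rewrite /s divfK// lt0r_neq0.
move=> h; apply: (le_trans h); rewrite ler_pM2r// /w.
have -> : (2 + (beta - alpha) / t) * t + alpha = 2 * t + beta.
  by field; exact: lt0r_neq0.
exact: lexx.
Unshelve. all: by end_near. Qed.

End Comparison.

(** * Barriers *)

Section Barrier.
Variable R : realType.
Implicit Types (x y : R * R).

(** A polynomial substitute for the distance to the circle, lying between that distance and twice
    it. *)
Definition bdepth rho x : R := (rho ^+ 2 - sqnorm x) / rho.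

Section Estimates.
Variables (rho lam : R) (y : R * R).
Hypotheses (rho0 : 0 < rho) (lam0 : 0 < lam) (lam1 : lam <= 1) (dy : disc rho y).

Lemma bdepth_gt0 x : disc rho x -> 0 < bdepth rho x.
Proof. by move=> dx; rewrite divr_gt0// subr_gt0. Qed.

Lemma hyp_bdepth x : disc rho x -> hyp rho x = 4 / bdepth rho x ^+ 2.
Proof.
move=> dx; rewrite /hyp /bdepth; field.
by rewrite !lt0r_neq0// subr_gt0.
Qed.

Lemma dist2_ge0 x z : 0 <= dist2 x z.
Proof. by rewrite addr_ge0 ?sqr_ge0. Qed.

Lemma dist2C x z : dist2 x z = dist2 z x.
Proof. by rewrite /dist2; ring. Qed.

Lemma bdepth_lipschitz x z : disc rho x -> disc rho z ->
  bdepth rho x <= bdepth rho z + 2 * Num.sqrt (dist2 x z).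
Proof.
move=> dx dz; rewrite -lerBlDl /bdepth -mulrBl ler_pdivrMr//.
have -> : rho ^+ 2 - sqnorm x - (rho ^+ 2 - sqnorm z) = sqnorm z - sqnorm x by ring.
have r0 : 0 <= Num.sqrt (dist2 x z) by exact: sqrtr_ge0.
have [le0|gt0] := leP (sqnorm z - sqnorm x) 0.
  by apply: (le_trans le0); rewrite !mulr_ge0// ltW.
have rr0 : 0 <= 2 * Num.sqrt (dist2 x z) * rho by rewrite !mulr_ge0// ltW.
rewrite -(@ler_pXn2r _ 2) ?nnegrE//; last exact: ltW.
rewrite !exprMn sqr_sqrtr ?dist2_ge0//.
have : (sqnorm z - sqnorm x) ^+ 2 <= dist2 x z * (2 * sqnorm x + 2 * sqnorm z).
  rewrite /dist2 /sqnorm -subr_ge0.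
  set L := (X in 0 <= X).
  (* Lagrange's identity for x - z and x + z gives the first square, the parallelogram law the
     second. *)
  have -> : L = ((x.1 - z.1) * (x.2 + z.2) - (x.2 - z.2) * (x.1 + z.1)) ^+ 2
     + ((x.1 - z.1) ^+ 2 + (x.2 - z.2) ^+ 2) ^+ 2 by rewrite /L; ring.
  by rewrite addr_ge0 ?sqr_ge0.
move=> h; apply: (le_trans h).
have -> : 2 ^+ 2 * dist2 x z * rho ^+ 2 = dist2 x z * (4 * rho ^+ 2) by ring.
apply: ler_wpM2l; first exact: dist2_ge0.
by move: dx dz; rewrite /disc /=; lra.
Qed.

Let sg := (lam * bdepth rho y) ^- 2.

Lemma scale_gt0 : 0 < sg.
Proof. by rewrite invr_gt0 exprn_gt0// mulr_gt0// bdepth_gt0. Qed.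

Let Dy0 : 0 < bdepth rho y. Proof. exact: bdepth_gt0. Qed.

(** The left side is lam^2 / (lam^2 d(y)^2 + r^2), and d(x) <= d(y) + 2 r. It bounds the truncation
    error on the whole disc. *)
Lemma scale_far x : disc rho x -> lam ^+ 2 * sg / (1 + sg * dist2 x y) <= 2 * hyp rho x.
Proof.
move=> dx; have Dx0 := bdepth_gt0 dx; have sg0 := scale_gt0.
have d0 := dist2_ge0 x y.
have S1 : 0 < 1 + sg * dist2 x y by rewrite ltr_wpDr// mulr_ge0// ltW.
rewrite hyp_bdepth//.
have -> : lam ^+ 2 * sg / (1 + sg * dist2 x y) =
   lam ^+ 2 / ((lam * bdepth rho y) ^+ 2 + dist2 x y).
  rewrite /sg; field; rewrite !lt0r_neq0//=.
  rewrite ltr_wpDr// exprn_gt0// mulr_gt0//.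
have den : 0 < (lam * bdepth rho y) ^+ 2 + dist2 x y.
  by rewrite ltr_wpDr// exprn_gt0// mulr_gt0.
have -> : 2 * (4 / bdepth rho x ^+ 2) = 8 / bdepth rho x ^+ 2 by ring.
rewrite ler_pdivrMr// mulrAC ler_pdivlMr ?exprn_gt0//.
have h := bdepth_lipschitz dx dy.
set r := Num.sqrt _ in h.
have r0 : 0 <= r by exact: sqrtr_ge0.
have rE : dist2 x y = r ^+ 2 by rewrite sqr_sqrtr.
have h2 : bdepth rho x ^+ 2 <= 2 * bdepth rho y ^+ 2 + 8 * r ^+ 2.
  have : bdepth rho x ^+ 2 <= (bdepth rho y + 2 * r) ^+ 2.
    have Dyr : 0 <= bdepth rho y + 2 * r by move: Dy0; lra.
    by rewrite ler_pXn2r ?nnegrE// ltW.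
  have := sqr_ge0 (bdepth rho y - 2 * r); rewrite -subr_ge0.
  have -> : (bdepth rho y - 2 * r) ^+ 2 = bdepth rho y ^+ 2 - 4 * bdepth rho y * r + 4 * r ^+ 2 by ring.
  have -> : (bdepth rho y + 2 * r) ^+ 2 = bdepth rho y ^+ 2 + 4 * bdepth rho y * r + 4 * r ^+ 2 by ring.
  lra.
rewrite rE [(lam * _) ^+ 2]exprMn.
have l0 : 0 <= lam ^+ 2 by rewrite sqr_ge0.
have l1 : lam ^+ 2 <= 1 by rewrite expr_le1// ltW.
have a : lam ^+ 2 * bdepth rho x ^+ 2 <= lam ^+ 2 * (2 * bdepth rho y ^+ 2 + 8 * r ^+ 2).
  exact: ler_wpM2l.
have b : lam ^+ 2 * r ^+ 2 <= r ^+ 2 by rewrite ler_piMl// sqr_ge0.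
have c : 0 <= lam ^+ 2 * bdepth rho y ^+ 2 by rewrite mulr_ge0 ?sqr_ge0.
move: a b c; lra.
Qed.

(** Here r <= d(y) / 4, so the Lipschitz bound makes d(x) and d(y) agree up to a factor 2. *)
Lemma scale_near x : disc rho x -> sg * dist2 x y <= 1 / 16 ->
  hyp rho x <= 16 * (lam ^+ 2 * sg) /\ lam ^+ 2 * sg <= hyp rho x.
Proof.
move=> dx; have Dx0 := bdepth_gt0 dx.
have sgE : lam ^+ 2 * sg = (bdepth rho y ^+ 2)^-1.
  by rewrite /sg; field; rewrite !lt0r_neq0.
set r := Num.sqrt (dist2 x y).
have r0 : 0 <= r by exact: sqrtr_ge0.
have rE : dist2 x y = r ^+ 2 by rewrite sqr_sqrtr ?dist2_ge0.
have l1 : lam ^+ 2 <= 1 by rewrite expr_le1// ltW.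
move=> near0; have near_ : r ^+ 2 <= 1 / 16 * (lam * bdepth rho y) ^+ 2.
  have ld : 0 < (lam * bdepth rho y) ^+ 2 by rewrite exprn_gt0// mulr_gt0.
  by rewrite -rE -ler_pdivrMr// mulrC.
have ry : r <= bdepth rho y / 4.
  have Dy4 : 0 <= bdepth rho y / 4 by move: Dy0; lra.
  rewrite -(@ler_pXn2r _ 2) ?nnegrE//.
  apply: (le_trans near_); rewrite [(lam * _) ^+ 2]exprMn [(_ / 4) ^+ 2]expr_div_n.
  have : lam ^+ 2 * bdepth rho y ^+ 2 <= bdepth rho y ^+ 2.
    by rewrite ler_piMl// sqr_ge0.
  have -> : (4 : R) ^+ 2 = 16 by ring.
  lra.
have h1 := bdepth_lipschitz dx dy; have h2 := bdepth_lipschitz dy dx.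
rewrite -/r in h1; rewrite dist2C -/r in h2.
rewrite sgE hyp_bdepth//; split.
  rewrite ler_pdivrMr ?exprn_gt0// mulrAC ler_pdivlMr ?exprn_gt0//.
  have : bdepth rho y ^+ 2 <= (2 * bdepth rho x) ^+ 2.
    by apply: lerXn2r; rewrite ?nnegrE; move: Dx0 Dy0; lra.
  rewrite [(2 * _) ^+ 2]exprMn; have -> : (2 : R) ^+ 2 = 4 by ring.
  lra.
rewrite -[leLHS]mul1r ler_pdivrMr ?exprn_gt0// mulrAC ler_pdivlMr ?exprn_gt0// mul1r.
have : bdepth rho x ^+ 2 <= (2 * bdepth rho y) ^+ 2.
  by apply: lerXn2r; rewrite ?nnegrE; move: Dx0 Dy0; lra.
by rewrite [(2 * _) ^+ 2]exprMn; have -> : (2 : R) ^+ 2 = 4 by ring.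
Qed.

Lemma powR_le (p a b : R) : 0 <= p -> 0 < a -> a <= b -> a `^ p <= b `^ p.
Proof.
move=> p0 a0 ab; apply: ge0_ler_powR => //; rewrite nnegrE ltW//.
exact: lt_le_trans ab.
Qed.

Lemma powR_le_neg (p a b : R) : p <= 0 -> 0 < a -> a <= b -> b `^ p <= a `^ p.
Proof.
move=> p0 a0 ab; have b0 := lt_le_trans a0 ab.
rewrite -[p]opprK !(powRN _ (- p)) lef_pV2 ?posrE ?powR_gt0//.
by apply: powR_le => //; rewrite oppr_ge0.
Qed.

(** Subadditivity of z^p. It bounds the second potential independently of the distance to the
    mass. *)
Lemma powR_gap (p a b : R) : 0 < p -> p < 1 -> 0 < a -> a <= b -> b <= a + 1 ->
  0 <= b `^ p - a `^ p <= 1.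
Proof.
move=> p0 p1 a0 ab ba; rewrite subr_ge0 lerBlDl.
have b0 := lt_le_trans a0 ab.
apply/andP; split; first by apply: powR_le => //; exact: ltW.
have a1 : 0 < a + 1 by rewrite addr_gt0.
apply: (@le_trans _ _ ((a + 1) `^ p)); first by apply: powR_le => //; exact: ltW.
rewrite -(@mulr_powRB1 _ (a + 1))// ?(ltW a1)// -(@mulr_powRB1 _ a)// ?(ltW a0)//.
have dec (z : R) : 0 < z -> z <= a + 1 -> (a + 1) `^ (p - 1) <= z `^ (p - 1).
  by move=> z0 za; apply: powR_le_neg => //; rewrite subr_le0 ltW.
rewrite mulrDl mul1r lerD//.
  by rewrite ler_pM2l//; apply: dec => //; rewrite lerDl.
by apply: (le_trans (dec 1 _ _)); rewrite ?powR1// lerDr ltW.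
Qed.

(** The potential A lam^2 (S1^p - Se^p) cancels the singular density h (S1 / Se)^(1 - p) near [y]
    and costs only a multiple of h elsewhere. *)
Lemma barrier (p e S1 Se A : R) x :
  disc rho x -> 0 < p -> p < 1 -> 0 < e -> e <= 1 ->
  S1 = 1 + sg * dist2 x y -> Se = e + sg * dist2 x y -> A = 8 / p ^+ 2 ->
  hyp rho x * (S1 / Se) `^ (1 - p)
  + A * lam ^+ 2 * (4 * sg * (p ^+ 2 * S1 `^ (p - 1) + p * (1 - p) * 1 * S1 `^ (p - 2))
     - 4 * sg * (p ^+ 2 * Se `^ (p - 1) + p * (1 - p) * e * Se `^ (p - 2)))
  <= (17 + 4 * A) * hyp rho x.
Proof.
move=> dx p0 p1 e0 e1 S1E SeE AE.
have A0 : 0 < A by rewrite AE divr_gt0// exprn_gt0.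
have sg0 := scale_gt0; have d0 := dist2_ge0 x y.
have sd0 : 0 <= sg * dist2 x y by rewrite mulr_ge0// ltW.
have Se0 : 0 < Se by rewrite SeE ltr_wpDr.
have S11 : 1 <= S1 by rewrite S1E lerDl.
have S10 : 0 < S1 by exact: lt_le_trans S11.
have SeS1 : Se <= S1 by rewrite S1E SeE lerD2r.
have h0 := hyp_gt0 rho0 dx.
have q0 : 0 <= 1 - p by lra.
pose L := lam ^+ 2 * sg.
have L0 : 0 < L by rewrite mulr_gt0// exprn_gt0.
have far : L / S1 <= 2 * hyp rho x by rewrite S1E; exact: scale_far.
have pq : 4 * (p * (1 - p)) <= 1.
  by have := sqr_ge0 (2 * p - 1); rewrite expr2; lra.
have pq0 : 0 <= p * (1 - p) by rewrite mulr_ge0// ltW.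
have P1 : S1 `^ (p - 1) <= 1.
  by rewrite -[leRHS](powRr0 S1) ler_powR//; lra.
have P2 : S1 `^ (p - 2) <= S1^-1.
  by rewrite -powR_inv1 ?(ltW S10)// ler_powR//; lra.
have Q1 : S1 `^ (p - 1) <= Se `^ (p - 1).
  by apply: powR_le_neg => //; rewrite subr_le0 ltW.
have Q2 : 0 <= e * Se `^ (p - 2) by rewrite mulr_ge0 ?powR_ge0// ltW.
have P10 : 0 <= S1 `^ (p - 1) := powR_ge0 _ _.
have P20 : 0 <= S1 `^ (p - 2) := powR_ge0 _ _.
set T1 := S1 `^ (p - 1) in P1 Q1 P10 *; set T2 := S1 `^ (p - 2) in P2 P20 *.
set U1 := Se `^ (p - 1) in Q1 *; set U2 := Se `^ (p - 2) in Q2 *.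
have e4 : 4 * (p * (1 - p)) * (e * U2) * (A * L) >= 0.
  have AL : 0 <= A * L by rewrite mulr_ge0// ltW.
  by apply: mulr_ge0 => //; apply: mulr_ge0 => //; apply: mulr_ge0.
have -> : A * lam ^+ 2 * (4 * sg * (p ^+ 2 * T1 + p * (1 - p) * 1 * T2)
     - 4 * sg * (p ^+ 2 * U1 + p * (1 - p) * e * U2)) =
  A * L * (4 * p ^+ 2 * (T1 - U1)) + A * L * (4 * (p * (1 - p)) * T2)
   - 4 * (p * (1 - p)) * (e * U2) * (A * L) by rewrite /L; ring.
have AL0 : 0 < A * L by exact: mulr_gt0.
have T2b : A * L * (4 * (p * (1 - p)) * T2) <= A * L * T2.
  by rewrite ler_pM2l// ler_piMl.
have Ah : 0 <= A * hyp rho x by rewrite mulr_ge0// ltW.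
have [Sesmall|Sebig] := leP Se (1 / 16).
  have sd : sg * dist2 x y <= 1 / 16 by move: Sesmall; rewrite SeE; lra.
  have [n1 n2] := scale_near dx sd; rewrite -/L in n1 n2.
  have S12 : S1 <= 2 by rewrite S1E; lra.
  have R1 : (S1 / Se) `^ (1 - p) <= 2 * U1.
    have -> : (S1 / Se) `^ (1 - p) = S1 `^ (1 - p) * U1.
      by rewrite powRM ?invr_ge0 ?ltW// -powR_inv1 ?ltW// -powRrM /U1 mulN1r opprB.
    apply: ler_wpM2r; first exact: powR_ge0.
    apply: (le_trans _ S12); rewrite -[leRHS]powRr1 ?(ltW S10)//.
    by rewrite ler_powR//; lra.
  have U10 : 0 <= U1 := powR_ge0 _ _.
  have m1 : hyp rho x * (S1 / Se) `^ (1 - p) <= 16 * L * (2 * U1).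
    by apply: ler_pM => //; rewrite ?powR_ge0// ltW.
  (* The value [A = 8 / p ^+ 2] is fixed here: near [y] the density is at most 16 L times 2 [U1],
     which the last term removes. *)
  have -> : A * L * (4 * p ^+ 2 * (T1 - U1)) = 32 * L * T1 - 32 * L * U1.
    by rewrite AE; field; exact: lt0r_neq0.
  have p2 : p ^+ 2 <= 1 by rewrite expr_le1// ltW.
  have m2 : A * L * (4 * (p * (1 - p)) * T2) <= 4 * (p * (1 - p)) * (A * L).
    have pq4 : 0 <= 4 * (p * (1 - p)) by apply: mulr_ge0.
    rewrite [leRHS]mulrC ler_pM2l// ler_piMr//.
    by apply: (le_trans P2); rewrite invf_le1.
  have m3 : 32 * L * T1 <= 4 * p ^+ 2 * (A * L).
    have -> : 4 * p ^+ 2 * (A * L) = 32 * L.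
      by rewrite AE; field; exact: lt0r_neq0.
    by rewrite ler_piMr// mulr_ge0// ltW.
  have m4 : 4 * p ^+ 2 * (A * L) + 4 * (p * (1 - p)) * (A * L) <= 4 * (A * L).
    have -> : 4 * p ^+ 2 * (A * L) + 4 * (p * (1 - p)) * (A * L) = (4 * (A * L)) * p.
      by ring.
    have AL4 : 0 <= 4 * (A * L) by rewrite mulr_ge0// ltW.
    by rewrite ler_piMr// ltW.
  have m5 : A * L <= A * hyp rho x by rewrite ler_pM2l.
  have := ltW h0; move: m1 m2 m3 m4 m5 e4; lra.
(* Away from [y] the density is harmless: [S1 <= Se + 1] and [Se > 1 / 16]. *)
have R1 : (S1 / Se) `^ (1 - p) <= 17.
  have S17 : S1 / Se <= 17.
    by rewrite ler_pdivrMr//; move: Sebig SeS1; rewrite S1E SeE; lra.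
  have r1 : 1 <= S1 / Se by rewrite ler_pdivlMr// mul1r.
  apply: (le_trans _ S17); rewrite -[leRHS]powRr1 ?(le_trans _ r1)//.
  by rewrite ler_powR//; lra.
have m1 : hyp rho x * (S1 / Se) `^ (1 - p) <= hyp rho x * 17 by rewrite ler_pM2l.
have m2 : A * L * (4 * p ^+ 2 * (T1 - U1)) <= 0.
  by rewrite pmulr_rle0// pmulr_rle0 ?subr_le0// mulr_gt0// exprn_gt0.
have m3 : A * L * T2 <= A * (2 * hyp rho x).
  apply: (@le_trans _ _ (A * (L / S1))); last by rewrite ler_pM2l.
  by rewrite -mulrA ler_pM2l// ler_pM2l.
move: m1 m2 m3 T2b e4; lra.
Qed.

(* [e = eps^2 * sg] turns the Laplacian of [ln (1 + sg r^2) - ln (e + sg r^2)]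
   into the kernel [eps^2 / (pi (r^2 + eps^2)^2)] up to the factor [-4 pi]. *)
Lemma log_kernel_laplacian (eps e : R) x : disc rho x -> 0 < eps ->
  e = eps ^+ 2 * sg ->
  (4 * sg * 1 / (1 + sg * dist2 x y) ^+ 2 - 4 * sg * e / (e + sg * dist2 x y) ^+ 2)
    / (4 * pi)
  <= hyp rho x / lam ^+ 2 - eps ^+ 2 / (pi * (dist2 x y + eps ^+ 2) ^+ 2).
Proof.
move=> dx eps0 eE.
have pi2 : 2 <= pi :> R by exact: pi_ge2.
have := pi_gt0 R; move: (pi) pi2 => c c2 c0.
have sg0 := scale_gt0; have d0 := dist2_ge0 x y.
have sd0 : 0 <= sg * dist2 x y by rewrite mulr_ge0// ltW.
have S1 : 1 <= 1 + sg * dist2 x y by rewrite lerDl.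
have eps20 : 0 < eps ^+ 2 by rewrite exprn_gt0.
have den : 0 < dist2 x y + eps ^+ 2 by rewrite ltr_wpDl.
rewrite mulrBl.
have -> : 4 * sg * e / (e + sg * dist2 x y) ^+ 2 / (4 * c) =
    eps ^+ 2 / (c * (dist2 x y + eps ^+ 2) ^+ 2).
  have -> : e + sg * dist2 x y = sg * (dist2 x y + eps ^+ 2) by rewrite eE; ring.
  by rewrite eE; field; rewrite !lt0r_neq0.
rewrite lerD2r.
have far := scale_far dx; have h0 := hyp_gt0 rho0 dx.
have l20 : 0 < lam ^+ 2 by rewrite exprn_gt0.
have S10 : 0 < 1 + sg * dist2 x y by exact: lt_le_trans S1.
rewrite ler_pdivlMr//.
set S := 1 + _ in far S1 S10 *.
have -> : 4 * sg * 1 / S ^+ 2 / (4 * c) * lam ^+ 2 = lam ^+ 2 * sg / S / (S * c).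
  by field; rewrite !lt0r_neq0.
rewrite ler_pdivrMr ?mulr_gt0//; apply: (le_trans far).
rewrite mulrC ler_pM2l//.
by rewrite -[leLHS]mul1r ler_pM.
Qed.

End Estimates.
End Barrier.

(** * Riemann sums of the regularised Poisson kernel *)

Section RiemannKernel.
Variable R : realType.

Lemma mvt_real (f df : R -> R) (a b : R) : a <= b ->
  (forall z, is_derive z (1:R) f (df z)) ->
  exists2 c, a <= c <= b & f b - f a = df c * (b - a).
Proof.
move=> ab fdf; have [|c] := @MVT_segment R f df a b ab (fun x _ => fdf x).
  by apply: derivable_within_continuous => x _; have [] := fdf x.
by rewrite in_itv /= => ? ?; exists c.
Qed.

(** The mean value theorem picks a point in each cell; the Harnack constant [K] compares its value
    with that at the left endpoint. *)
Lemma riemann_cells (g F : R -> R) (s K z0 : R) m n : 0 < s -> (m <= n)%N ->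
  (forall z, is_derive z (1:R) F (g z)) ->
  (forall a b, `|a - b| <= s -> g a <= K * g b) ->
  F (z0 + n%:R * s) - F (z0 + m%:R * s) <=
    K * \sum_(m <= k < n) s * g (z0 + k%:R * s).
Proof.
move=> s0 mn Fg gK; rewrite -(telescope_sumr (fun k => F (z0 + k%:R * s)) mn) mulr_sumr.
apply: ler_sum => k _.
have le1 : z0 + k%:R * s <= z0 + k.+1%:R * s.
  by rewrite lerD2l ler_pM2r// ler_nat.
have E : z0 + k.+1%:R * s - (z0 + k%:R * s) = s by rewrite -natr1; ring.
have [c /andP[c1 c2] ->] := mvt_real le1 Fg.
rewrite E mulrCA mulrC ler_pM2l//; apply: gK.
rewrite ger0_norm ?subr_ge0//; move: c2; rewrite -[in leRHS](subrK (z0 + k%:R * s) (z0 + k.+1%:R * s)) E.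
by rewrite -lerBlDr.
Qed.

(** The whole cells inside the window cover it up to at most [s] at either end, hence the limits
    [s - h] and [h - s]. *)
Lemma riemann_window (g F : R -> R) (s K h x : R) N : 0 < s -> s <= h ->
  (forall z, is_derive z (1:R) F (g z)) -> (forall z, 0 <= g z) ->
  (forall a b, `|a - b| <= s -> g a <= K * g b) -> 0 <= K ->
  -1 <= x - h -> x + h <= -1 + N%:R * s ->
  F (h - s) - F (s - h) <=
    K * \sum_(0 <= k < N | `|-1 + k%:R * s - x| <= h) s * g (-1 + k%:R * s - x).
Proof.
move=> s0 sh Fg g0 gK K0 xl xr.
have Fmono a b : a <= b -> F a <= F b.
  move=> ab; have [c _ E] := mvt_real ab Fg.
  by rewrite -subr_ge0 E mulr_ge0// subr_ge0.
have frac_ge0 : 0 <= (x - h + 1) / s by apply: divr_ge0; lra.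
have frac2_ge0 : 0 <= (x + h + 1) / s by apply: divr_ge0; lra.
pose m := (Num.trunc ((x - h + 1) / s)).+1.
pose n := Num.trunc ((x + h + 1) / s).
have mlo : x - h <= -1 + m%:R * s.
  have : (x - h + 1) / s <= m%:R by rewrite ltW// truncnS_gt.
  by rewrite ler_pdivrMr//; lra.
have mhi : -1 + m%:R * s <= x - h + s.
  have : (Num.trunc ((x - h + 1) / s))%:R <= (x - h + 1) / s by rewrite truncn_le.
  by rewrite ler_pdivlMr// /m -natr1; lra.
have nhi : -1 + n%:R * s <= x + h.
  have : n%:R <= (x + h + 1) / s.
    by rewrite truncn_le.
  by rewrite ler_pdivlMr//; lra.
have nlo : x + h - s <= -1 + n%:R * s.
  have : (x + h + 1) / s <= n.+1%:R by rewrite ltW// truncnS_gt.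
  by rewrite ler_pdivrMr// -natr1; lra.
have [mn|nm] := leqP m n; last first.
  have sum0 : 0 <= K * \sum_(0 <= k < N | `|-1 + k%:R * s - x| <= h) s * g (-1 + k%:R * s - x).
    by rewrite mulr_ge0// sumr_ge0// => k _; rewrite mulr_ge0// ltW.
  apply: (le_trans _ sum0); rewrite subr_le0; apply: Fmono.
  have : n.+1%:R <= m%:R :> R by rewrite ler_nat.
  rewrite -natr1 => nm'.
  have : (n%:R + 1) * s <= m%:R * s by rewrite ler_pM2r.
  by lra.
have nN : (n <= N)%N.
  rewrite -(ler_nat R) -(ler_pM2r s0); move: nhi xr; lra.
have h1 : F (-1 + n%:R * s - x) - F (-1 + m%:R * s - x) <=
    K * \sum_(m <= k < n) s * g (-1 + k%:R * s - x).
  apply: (@riemann_cells (fun z => g (z - x)) (fun z => F (z - x))) => //.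
    move=> z; rewrite -[g _]mulr1.
    exact: (@is_derive1_comp _ F (shift (- x)) z _ _ (Fg _) (is_derive_shift _ _ _)).
  by move=> a b ab; apply: gK; rewrite opprB addrA subrK.
have {}h1 : F (h - s) - F (s - h) <= K * \sum_(m <= k < n) s * g (-1 + k%:R * s - x).
  by apply: le_trans h1; apply: lerB; apply: Fmono; lra.
apply: (le_trans h1); apply: ler_wpM2l => //.
rewrite [leRHS](@big_cat_nat _ _ _ m) //=; last exact: leq_trans nN.
rewrite [X in _ <= _ + X](@big_cat_nat _ _ _ n _ _) //=.
rewrite addrCA ler_wpDr//; first by apply: addr_ge0; apply: sumr_ge0 => k _; rewrite mulr_ge0// ltW.
rewrite [leRHS]big_mkcond /= ; apply: ler_sum_nat => k /andP[mk kn].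
rewrite ifT// ler_norml; apply/andP; split.
  have : m%:R * s <= k%:R * s by rewrite ler_pM2r// ler_nat.
  by lra.
have : k%:R * s <= n%:R * s by rewrite ler_pM2r// ler_nat ltnW.
by lra.
Qed.

(** The Laplacian of ln (a^2 + b^2 + eps^2) / (4 pi), a regularised fundamental solution; its
    integral over the plane is 1. *)
Definition kernel (eps a b : R) : R := eps ^+ 2 / (pi * (a ^+ 2 + b ^+ 2 + eps ^+ 2) ^+ 2).

Lemma is_derive_sqrD (c z : R) : is_derive z (1:R) (fun z => z ^+ 2 + c) (2 * z).
Proof.
have h : is_derive z (1:R) ((id : R -> R) ^+ 2 + cst c) (2%:R * z ^+ 1 *: 1 + 0).
  exact: is_deriveD.
by apply: (is_derive_eq h); rewrite addr0 expr1 /GRing.scale /= mulr1.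
Qed.

(** Primitive for integrating the kernel along a row, with c^2 = b^2 + eps^2; a full line gives pi /
    (2 c^3). *)
Lemma is_derive_row (c z : R) : 0 < c ->
  is_derive z (1:R)
    (fun z => z * (2 * c ^+ 2 * (z ^+ 2 + c ^+ 2))^-1 + atan (c^-1 * z) * (2 * c ^+ 3)^-1)
    ((z ^+ 2 + c ^+ 2) ^- 2).
Proof.
move=> c0; have c20 : 0 < c ^+ 2 by rewrite exprn_gt0.
have d0 : 0 < z ^+ 2 + c ^+ 2 by rewrite ltr_wpDl ?sqr_ge0.
have d1 : 2 * c ^+ 2 * (z ^+ 2 + c ^+ 2) != 0 by rewrite lt0r_neq0// !mulr_gt0.
have h1 : is_derive z (1:R) (fun z => 2 * c ^+ 2 * (z ^+ 2 + c ^+ 2)) (2 * c ^+ 2 * (2 * z)).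
  exact: (is_deriveZ _ (is_derive_sqrD (c ^+ 2) z)).
have h2 := is_deriveM (is_derive_id z (1:R)) (@is_deriveV R (fun z => 2 * c ^+ 2 * (z ^+ 2 + c ^+ 2)) z _ 1 d1 h1).
have h3 : is_derive z (1:R) (fun z => c^-1 * z) (c^-1 * 1).
  exact: (is_deriveZ _ (is_derive_id z (1:R))).
have h4 := @is_derive1_comp _ (@atan R) (fun z => c^-1 * z) z _ _ (is_derive1_atan (c^-1 * z)) h3.
have h5 := is_deriveM h4 (is_derive_cst ((2 * c ^+ 3)^-1) z (1:R)).
apply: (is_derive_eq (is_deriveD h2 h5)).
rewrite /GRing.scale /= mulr0 add0r !mulr1.
field; rewrite !lt0r_neq0//.
Qed.

(** Primitive of what the row integrals leave behind; over a full line it grows by 2. *)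
Lemma is_derive_col (eps z : R) : 0 < eps ->
  is_derive z (1:R) (fun z => z * (Num.sqrt (z ^+ 2 + eps ^+ 2))^-1)
    (eps ^+ 2 * (Num.sqrt (z ^+ 2 + eps ^+ 2)) ^- 3).
Proof.
move=> e0; have e20 : 0 < eps ^+ 2 by rewrite exprn_gt0.
have d0 : 0 < z ^+ 2 + eps ^+ 2 by rewrite ltr_wpDl ?sqr_ge0.
have h1 := @is_derive1_comp _ Num.sqrt (fun z => z ^+ 2 + eps ^+ 2) z _ _ (is_derive1_sqrt d0) (is_derive_sqrD (eps ^+ 2) z).
have q0 : 0 < Num.sqrt (z ^+ 2 + eps ^+ 2) by rewrite sqrtr_gt0.
have h2 := is_deriveM (is_derive_id z (1:R)) (@is_deriveV R (fun z => Num.sqrt (z ^+ 2 + eps ^+ 2)) z _ 1 (lt0r_neq0 q0) h1).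
apply: (is_derive_eq h2); rewrite /GRing.scale /=.
have E : Num.sqrt (z ^+ 2 + eps ^+ 2) ^+ 2 = z ^+ 2 + eps ^+ 2 by rewrite sqr_sqrtr// ltW.
set r := Num.sqrt _ in q0 E *.
have -> : eps ^+ 2 = r ^+ 2 - z ^+ 2 by rewrite E; ring.
by field; exact: lt0r_neq0.
Qed.

(** Source of the Harnack constants: the cross term obeys 2 a d <= th (a^2 + eps^2), so a shift by
    [th * eps] costs a relative error uniform in the position. *)
Lemma sqrD_near (th c eps s a b : R) : 0 <= th -> th <= 1 -> 0 <= eps ->
  eps ^+ 2 <= c -> 0 <= s -> s <= th * eps -> `|a - b| <= s ->
  b ^+ 2 + c <= (1 + 2 * th) * (a ^+ 2 + c).
Proof.
move=> th0 th1 e0 ec s0 sth ab.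
set d := b - a; have bE : b = a + d by rewrite /d addrC subrK.
have ds : `|d| <= th * eps by rewrite /d distrC (le_trans ab).
have dd : d ^+ 2 <= th * eps ^+ 2.
  rewrite -(real_normK (num_real d)); apply: (@le_trans _ _ ((th * eps) ^+ 2)).
    by rewrite lerXn2r ?nnegrE// mulr_ge0.
  by rewrite exprMn ler_wpM2r ?sqr_ge0// expr2 ler_piMr.
have ad : 2 * a * d <= th * (a ^+ 2 + eps ^+ 2).
  apply: (@le_trans _ _ (2 * `|a| * (th * eps))).
    apply: (le_trans (ler_norm _)); rewrite !normrM ger0_norm//.
    by rewrite ler_wpM2l// mulr_ge0.
  rewrite -subr_ge0.
  have -> : th * (a ^+ 2 + eps ^+ 2) - 2 * `|a| * (th * eps) = th * (`|a| - eps) ^+ 2.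
    by rewrite -(real_normK (num_real a)); ring.
  by rewrite mulr_ge0// sqr_ge0.
have te : th * eps ^+ 2 <= th * c by rewrite ler_wpM2l.
have ta : 0 <= th * a ^+ 2 by rewrite mulr_ge0// sqr_ge0.
have -> : b ^+ 2 = a ^+ 2 + 2 * a * d + d ^+ 2 by rewrite bE; ring.
by move: (d ^+ 2) (2 * a * d) dd ad te ta => D1 D2; lra.
Qed.

Lemma row_sum (th c eps s h x : R) N : 0 < th -> th <= 1 -> 0 < eps ->
  eps <= c -> 0 < s -> s <= th * eps -> s <= h ->
  -1 <= x - h -> x + h <= -1 + N%:R * s ->
  atan ((h - s) / c) / c ^+ 3 <= (1 + 2 * th) ^+ 2 *
    \sum_(0 <= k < N | `|-1 + k%:R * s - x| <= h)
      s * ((-1 + k%:R * s - x) ^+ 2 + c ^+ 2) ^- 2.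
Proof.
move=> th0 th1 e0 ec s0 sth sh xl xr.
have c0 : 0 < c by exact: lt_le_trans ec.
have c20 : 0 < c ^+ 2 by rewrite exprn_gt0.
have pos (z : R) : 0 < z ^+ 2 + c ^+ 2 by rewrite ltr_wpDl ?sqr_ge0.
have K0 : 0 <= (1 + 2 * th) ^+ 2 by rewrite sqr_ge0.
have lip (a b : R) : `|a - b| <= s ->
    (a ^+ 2 + c ^+ 2) ^- 2 <= (1 + 2 * th) ^+ 2 * (b ^+ 2 + c ^+ 2) ^- 2.
  move=> ab; rewrite ler_pdivlMr ?exprn_gt0// mulrC ler_pdivrMr ?exprn_gt0//.
  have K1 : 0 <= 1 + 2 * th by lra.
  have ec2 : eps ^+ 2 <= c ^+ 2 by rewrite lerXn2r ?nnegrE ?(ltW e0) ?(ltW c0).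
  rewrite -exprMn; apply: lerXn2r; rewrite ?nnegrE ?mulr_ge0 ?(ltW (pos _))//.
  exact: (sqrD_near (ltW th0) th1 (ltW e0) ec2 (ltW s0) sth ab).
have := riemann_window s0 sh (fun z => is_derive_row z c0) _ lip K0 xl xr.
move=> /(_ (fun z => ltW _)) h1; apply: (le_trans _ (h1 _)); last first.
  by move=> z; rewrite invr_gt0 exprn_gt0.
have -> : s - h = - (h - s) by rewrite opprB.
set w := h - s; have w0 : 0 <= w by rewrite subr_ge0.
rewrite sqrrN mulrN atanN !mulNr [c^-1 * w]mulrC.
have -> : atan (w / c) / c ^+ 3 = atan (w / c) / (2 * c ^+ 3) + atan (w / c) / (2 * c ^+ 3).
  by field; exact: lt0r_neq0.
have : 0 <= w / (2 * c ^+ 2 * (w ^+ 2 + c ^+ 2)).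
  by rewrite divr_ge0// !mulr_ge0// ltW.
lra.
Qed.

Lemma col_sum (th eps s h x : R) N : 0 < th -> th <= 1 -> 0 < eps ->
  0 < s -> s <= th * eps -> s <= h ->
  -1 <= x - h -> x + h <= -1 + N%:R * s ->
  2 * ((h - s) / Num.sqrt ((h - s) ^+ 2 + eps ^+ 2)) <= (1 + 2 * th) ^+ 3 *
    \sum_(0 <= k < N | `|-1 + k%:R * s - x| <= h)
      s * (eps ^+ 2 * Num.sqrt ((-1 + k%:R * s - x) ^+ 2 + eps ^+ 2) ^- 3).
Proof.
move=> th0 th1 e0 s0 sth sh xl xr.
have e20 : 0 < eps ^+ 2 by rewrite exprn_gt0.
have pos (z : R) : 0 < z ^+ 2 + eps ^+ 2 by rewrite ltr_wpDl ?sqr_ge0.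
have spos (z : R) : 0 < Num.sqrt (z ^+ 2 + eps ^+ 2) by rewrite sqrtr_gt0.
have K1 : 1 <= 1 + 2 * th by lra.
have K10 : 0 <= 1 + 2 * th by lra.
have K0 : 0 <= (1 + 2 * th) ^+ 3 by rewrite exprn_ge0.
have lip (a b : R) : `|a - b| <= s ->
    eps ^+ 2 * Num.sqrt (a ^+ 2 + eps ^+ 2) ^- 3 <=
    (1 + 2 * th) ^+ 3 * (eps ^+ 2 * Num.sqrt (b ^+ 2 + eps ^+ 2) ^- 3).
  move=> ab; rewrite [leRHS]mulrCA ler_pM2l//.
  rewrite ler_pdivlMr ?exprn_gt0// mulrC ler_pdivrMr ?exprn_gt0//.
  rewrite -exprMn; apply: lerXn2r; rewrite ?nnegrE ?mulr_ge0 ?(ltW (spos _))//.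
  have := @sqrD_near th (eps ^+ 2) eps s a b (ltW th0) th1 (ltW e0) (lexx _) (ltW s0) sth ab.
  move=> h1; apply: (@le_trans _ _ (Num.sqrt ((1 + 2 * th) ^+ 2 * (a ^+ 2 + eps ^+ 2)))).
    rewrite ler_wsqrtr// (le_trans h1)// ler_wpM2r// ?(ltW (pos _))//.
    by rewrite expr2 ler_peMr.
  by rewrite sqrtrM ?sqr_ge0// sqrtr_sqr ger0_norm.
have := riemann_window s0 sh (fun z => is_derive_col z e0) _ lip K0 xl xr.
move=> h1; apply: (le_trans _ (h1 _)); last first.
  by move=> z; rewrite mulr_ge0 ?invr_ge0 ?exprn_ge0 ?ltW.
have -> : s - h = - (h - s) by rewrite opprB.
by rewrite sqrrN mulNr opprK -mulr2n mulr_natl.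
Qed.

Lemma kernel_ge0 (eps a b : R) : 0 <= kernel eps a b.
Proof. by rewrite divr_ge0 ?sqr_ge0// mulr_ge0 ?pi_ge0// sqr_ge0. Qed.

(** Of the seven factors [a], two come from the Harnack constant of the rows, three from that of the
    columns, and one each from cutting off the two primitives. *)
Lemma kernel_mass (a h eps0 : R) : 1 < a -> a <= 2 -> 0 < h -> 0 < eps0 ->
  exists2 eps, 0 < eps <= eps0 & exists2 s0, 0 < s0 & forall (s x1 x2 : R) N,
    0 < s -> s <= s0 -> -1 <= x1 - h -> x1 + h <= -1 + N%:R * s ->
    -1 <= x2 - h -> x2 + h <= -1 + N%:R * s ->
    1 <= a ^+ 7 * \sum_(0 <= j < N | `|-1 + j%:R * s - x2| <= h)
      \sum_(0 <= i < N | `|-1 + i%:R * s - x1| <= h)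
        s * s * kernel eps (-1 + i%:R * s - x1) (-1 + j%:R * s - x2).
Proof.
move=> a1 a2 h0 e00.
have a0 : 0 < a by exact: lt_trans a1.
pose th := (a - 1) / 2.
have th0 : 0 < th by rewrite /th; lra.
have th1 : th <= 1 by rewrite /th; lra.
have thE : 1 + 2 * th = a by rewrite /th; field.
have pi0 := pi_gt0 R.
(* Cut-off in units of [eps]: each primitive evaluated at [T] is within a factor [a] of its
   limit. *)
have [T [T1 Tatan Ta]] : exists T, [/\ 1 <= T, pi / 2 / a <= atan T &
    1 <= (a ^+ 2 - 1) * T ^+ 2 ].
  have lt1 : pi / 2 / a < pi / 2 by rewrite ltr_pdivrMr// ltr_pMr// divr_gt0.
  have a21 : 0 < a ^+ 2 - 1 by rewrite subr_gt0 expr_gt1// ltW.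
  have /cvgr_gt/(_ _ lt1) := @cvgy_atan R.
  move=> [B [_ hB]].
  pose T := Num.max (B + 1) (Num.max 1 (a ^+ 2 - 1)^-1).
  have T1 : 1 <= T by rewrite !le_max lexx orbT.
  exists T; split => //.
    by apply/ltW/hB; rewrite lt_max ltrDl ltr01.
  rewrite -ler_pdivrMl// mulr1; apply: (@le_trans _ _ T).
    by rewrite !le_max lexx !orbT.
  by rewrite expr2 ler_peMr// (le_trans ler01).
have T0 : 0 < T by exact: lt_le_trans T1.
have TT0 : 0 < 2 * T * (T + 2) by rewrite !mulr_gt0// addr_gt0.
pose eps := Num.min eps0 (h / (2 * T * (T + 2))).
have eps_gt0 : 0 < eps by rewrite lt_min e00 divr_gt0.
have epsh : T * ((T + 2) * eps) <= h / 2.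
  have : eps <= h / (2 * T * (T + 2)) by rewrite ge_min lexx orbT.
  by rewrite ler_pdivlMr//; lra.
exists eps; first by rewrite eps_gt0 ge_min lexx.
exists (th * eps); first exact: mulr_gt0.
move=> s x1 x2 N s0 sth l1 r1 l2 r2.
have seps : s <= eps by apply: (le_trans sth); rewrite ler_piMl// ltW.
have T2e : T * eps + 2 * eps <= h / 2.
  apply: le_trans epsh; rewrite -mulrDl ler_peMl// mulr_ge0 ?ltW//; lra.
have Te : 0 < T * eps by exact: mulr_gt0.
(* Columns are summed over this shorter window only. There the row width [cc b] is at most
   [(T + 2) * eps], so every row still reaches past [T] times its width. *)
pose h2 := T * eps + eps.
have h2h : h2 <= h by rewrite /h2; lra.
have e20 : 0 < eps ^+ 2 by rewrite exprn_gt0.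
have pos (z : R) : 0 < z ^+ 2 + eps ^+ 2 by rewrite ltr_wpDl ?sqr_ge0.
pose cc (z : R) := Num.sqrt (z ^+ 2 + eps ^+ 2).
have cc0 z : 0 < cc z by rewrite sqrtr_gt0.
have ccE z : cc z ^+ 2 = z ^+ 2 + eps ^+ 2 by rewrite sqr_sqrtr// ltW.
have col : 2 * ((h2 - s) / cc (h2 - s)) <= (1 + 2 * th) ^+ 3 *
    \sum_(0 <= k < N | `|-1 + k%:R * s - x2| <= h2)
      s * (eps ^+ 2 * cc (-1 + k%:R * s - x2) ^- 3).
  by apply: col_sum => //; rewrite /h2; lra.
have G : a^-1 <= (h2 - s) / cc (h2 - s).
  have w0 : T * eps <= h2 - s by rewrite /h2; lra.
  have w1 : 0 < h2 - s by exact: lt_le_trans w0.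
  rewrite ler_pdivlMr// ler_pdivrMl//.
  rewrite -(@ler_pXn2r _ 2) ?nnegrE ?mulr_ge0 ?(ltW (cc0 _)) ?(ltW a0) ?(ltW w1)//.
  rewrite ccE exprMn -lerBrDl.
  have -> : a ^+ 2 * (h2 - s) ^+ 2 - (h2 - s) ^+ 2 = (a ^+ 2 - 1) * (h2 - s) ^+ 2 by ring.
  apply: (@le_trans _ _ ((a ^+ 2 - 1) * (T * eps) ^+ 2)).
    by rewrite exprMn mulrA ler_peMl// ltW.
  rewrite ler_wpM2l//; first by rewrite subr_ge0 exprn_ege1// ltW.
  by apply: lerXn2r; rewrite ?nnegrE ?(ltW Te) ?(ltW w1).
have row k : `|-1 + k%:R * s - x2| <= h2 ->
    (2 * a ^+ 3)^-1 * (s * (eps ^+ 2 * cc (-1 + k%:R * s - x2) ^- 3)) <=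
    \sum_(0 <= i < N | `|-1 + i%:R * s - x1| <= h)
        s * s * kernel eps (-1 + i%:R * s - x1) (-1 + k%:R * s - x2).
  set b := _ - x2 => bh.
  have ec : eps <= cc b.
    rewrite -(@ler_pXn2r _ 2) ?nnegrE ?(ltW eps_gt0) ?(ltW (cc0 _))//.
    by rewrite ccE lerDr sqr_ge0.
  have ce : cc b <= (T + 2) * eps.
    have T2 : 0 <= (T + 2) * eps by rewrite mulr_ge0 ?addr_ge0// ltW.
    rewrite -(@ler_pXn2r _ 2) ?nnegrE ?(ltW (cc0 _))//.
    rewrite ccE -(real_normK (num_real b)).
    apply: (@le_trans _ _ (h2 ^+ 2 + eps ^+ 2)).
      by rewrite lerD2r; apply: lerXn2r; rewrite ?nnegrE// (le_trans _ bh).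
    rewrite -subr_ge0 /h2.
    have -> : ((T + 2) * eps) ^+ 2 - ((T * eps + eps) ^+ 2 + eps ^+ 2) =
      2 * (T * eps ^+ 2) + 2 * eps ^+ 2 by ring.
    by rewrite addr_ge0// !mulr_ge0// ltW.
  have sh : s <= h by lra.
  have := row_sum th0 th1 eps_gt0 ec s0 sth sh l1 r1.
  rewrite thE => hrow.
  have at1 : pi / 2 / a <= atan ((h - s) / cc b).
    apply: (le_trans Tatan); apply: le_atan.
    rewrite ler_pdivlMr//; apply: (@le_trans _ _ (T * ((T + 2) * eps))).
      by rewrite ler_pM2l.
    by apply: (le_trans epsh); lra.
  have {}hrow := le_trans (ler_wpM2r _ at1) hrow.
  have -> : \sum_(0 <= i < N | `|-1 + i%:R * s - x1| <= h)
        s * s * kernel eps (-1 + i%:R * s - x1) b =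
     (s * (eps ^+ 2 / pi)) * \sum_(0 <= k < N | `|-1 + k%:R * s - x1| <= h)
              s * ((-1 + k%:R * s - x1) ^+ 2 + cc b ^+ 2) ^- 2.
    rewrite mulr_sumr; apply: eq_bigr => i _; rewrite /kernel ccE addrA invfM; ring.
  rewrite -(@ler_pM2l _ (a ^+ 2)) ?exprn_gt0// [leRHS]mulrCA.
  apply: (@le_trans _ _ (s * (eps ^+ 2 / pi) * (pi / 2 / a * (cc b ^+ 3)^-1))).
    rewrite le_eqVlt; apply/orP; left; apply/eqP.
    move: (pi : R) pi0 => c c0; have := cc0 b; move: (cc b) => d d0.
    by field; rewrite !lt0r_neq0.
  rewrite ler_wpM2l//; first by rewrite mulr_ge0 ?divr_ge0 ?(ltW pi0) ?(ltW s0) ?(ltW e20).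
  by apply: hrow; rewrite invr_ge0 exprn_ge0// ltW.
have a3 : 0 < a ^+ 3 by rewrite exprn_gt0.
have fin : 2 * a^-1 <= a ^+ 3 * (2 * a ^+ 3 *
     \sum_(0 <= j < N | `|-1 + j%:R * s - x2| <= h)
      \sum_(0 <= i < N | `|-1 + i%:R * s - x1| <= h)
        s * s * kernel eps (-1 + i%:R * s - x1) (-1 + j%:R * s - x2)).
  apply: (@le_trans _ _ (2 * ((h2 - s) / cc (h2 - s)))); first by rewrite ler_pM2l.
  apply: (le_trans col); rewrite thE ler_pM2l// -ler_pdivrMl ?mulr_gt0//.
  rewrite mulr_sumr big_mkcond [leRHS]big_mkcond /=.
  apply: ler_sum => k _.
  have [k2|_] := leP (`|-1 + k%:R * s - x2|) h2.
    by rewrite (le_trans k2 h2h); exact: row.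
  case: ifP => // _; apply: sumr_ge0 => i _.
  by rewrite mulr_ge0 ?kernel_ge0// mulr_ge0// ltW.
set Sg := (X in a ^+ 3 * (_ * X)) in fin *.
have : 2 * a^-1 * (a / 2) <= a ^+ 3 * (2 * a ^+ 3 * Sg) * (a / 2).
  by rewrite ler_pM2r// divr_gt0.
have -> : 2 * a^-1 * (a / 2) = 1 by field; exact: lt0r_neq0.
have -> // : a ^+ 3 * (2 * a ^+ 3 * Sg) * (a / 2) = a ^+ 7 * Sg by field.
Qed.
End RiemannKernel.

(** * Discretization of the initial excess *)

Section GridSum.
Variable R : realType.
Implicit Types (f : R * R -> R) (s : R).

Definition grid s (p : nat * nat) : R * R := (-1 + p.1%:R * s, -1 + p.2%:R * s).

Definition square s (p : nat * nat) : set (R * R) :=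
  `[(grid s p).1, (grid s p).1 + s[%classic `*` `[(grid s p).2, (grid s p).2 + s[%classic.

Lemma unit_discE (x : R * R) : @unit_disc R x <-> disc 1 x.
Proof.
rewrite /unit_disc /disc /enorm /sqnorm /= -[X in _ < X]sqrtr1 expr1n.
by rewrite ltr_sqrt.
Qed.

Let RR := (measurableTypeR R * measurableTypeR R)%type.

Lemma measurable_unit_disc : measurable (@unit_disc R : set RR).
Proof.
have -> : @unit_disc R = (@sqnorm R) @^-1` `]-oo, 1[%classic.
  apply/seteqP; split => x; rewrite /= in_itv /=.
    by move=> /unit_discE; rewrite /disc /= expr1n.
  by move=> h; apply/unit_discE; rewrite /disc /= expr1n.
rewrite -[X in measurable X]setTI; apply: (_ : measurable_fun setT (@sqnorm R : RR -> R)) => //.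
by apply: measurable_funD; apply: measurable_funX;
  [exact: measurable_fst|exact: measurable_snd].
Qed.

Lemma measurable_square s p : measurable (square s p : set RR).
Proof. by apply: measurableX; exact: measurable_itv. Qed.

Lemma measure_square s p : 0 < s -> @lebesgue2 R (square s p) = (s ^+ 2)%:E.
Proof.
move=> s0; rewrite /lebesgue2 product_measure1E; try exact: measurable_itv.
have E (a : R) : @lebesgue_measure R `[a, a + s[%classic = s%:E.
  rewrite lebesgue_measure_itv /= lte_fin ltrDl s0 -EFinD.
  by congr EFin; ring.
by rewrite [X in (X * _)%E]E [X in (_ * X)%E]E -EFinM expr2.
Qed.

Lemma trivIset_square s (A : set (nat * nat)) : 0 < s -> trivIset A (square s).
Proof.
move=> s0 [i j] [i' j'] _ _ [z [[/= a b] [/= c d]]].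
have key (m n : nat) (t : R) : t \in `[-1 + m%:R * s, -1 + m%:R * s + s[%R ->
    t \in `[-1 + n%:R * s, -1 + n%:R * s + s[%R -> (m <= n)%N.
  rewrite !in_itv /= => /andP[t1 t2] /andP[t3 t4].
  rewrite -ltnS -(ltr_nat R) -(ltr_pM2r s0) -natr1; lra.
congr (_, _); apply/eqP; rewrite eqn_leq; apply/andP; split.
- exact: key a c.
- exact: key c a.
- exact: key b d.
- exact: key d b.
Qed.

Lemma sum_squares_le f s (l : seq (nat * nat)) (c : nat * nat -> R) :
  (forall x, 0 <= f x) ->
  (@lebesgue2 R).-integrable (@unit_disc R) (fun x => (f x)%:E) ->
  0 < s -> uniq l -> (forall p, p \in l -> 0 <= c p) ->
  (forall p, p \in l -> square s p `<=` @unit_disc R) ->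
  (forall p z, p \in l -> square s p z -> c p <= f z) ->
  \sum_(p <- l) c p * s ^+ 2 <= L1norm f.
Proof.
move=> f0 fi s0 ul c0 sub cf.
have mD := measurable_unit_disc.
have fin := integrable_fin_num mD fi.
have mf := measurable_int _ fi.
have -> : L1norm f = fine (\int[@lebesgue2 R]_(x in @unit_disc R) (f x)%:E)%E.
  rewrite /L1norm /Rintegral; congr fine.
  by apply: eq_integral => x _; rewrite ger0_norm.
rewrite -lee_fin fineK// -sumEFin.
pose D := \big[setU/set0]_(p <- l) square s p.
have DD : D `<=` @unit_disc R.
  move=> z; rewrite /D -bigcup_seq => -[p /= pl]; exact: sub.
have mDD : measurable D.
  by apply: bigsetU_measurable => p _; exact: measurable_square.
have f0' (x : R * R) : (0 <= (f x)%:E)%E by rewrite lee_fin.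
apply: (@le_trans _ _ (\int[@lebesgue2 R]_(x in D) (f x)%:E)%E); last first.
  exact: ge0_subset_integral.
rewrite ge0_integral_bigsetU//; last first.
- exact: measurable_funS mf.
- exact: trivIset_square.
- by move=> p; exact: measurable_square.
rewrite big_seq [leRHS]big_seq; apply: lee_sum => p pl.
rewrite EFinM -(measure_square p s0) -integral_cst//; last exact: measurable_square.
apply: ge0_le_integral => //.
- exact: measurable_square.
- by move=> x _; rewrite /= lee_fin c0.
- apply: (measurable_funS mD) mf; exact: sub.
- by move=> x px; rewrite lee_fin; exact: cf px.
Qed.


(** Only [x] is confined to the compact disc, so squares sticking out of it can be treated too. *)
Lemma unif_continuous_disc f (r2 e : R) : 0 <= r2 -> r2 < 1 -> 0 < e ->
  (forall x, disc 1 x -> {for x, continuous f}) ->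
  exists2 d, 0 < d & forall x y : R * R, sqnorm x <= r2 ^+ 2 ->
    `|x.1 - y.1| < d -> `|x.2 - y.2| < d -> f x <= f y + e.
Proof.
move=> r0 r1 e0 fc.
pose K := [set x : R * R | sqnorm x <= r2 ^+ 2].
have cK : compact K by apply: (sqnorm_le_compact r0).
have e20 : 0 < e / 2 by exact: divr_gt0.
have r21 : r2 ^+ 2 < 1 by rewrite expr_lt1.
pose P (d : R) (x : R * R) := forall y : R * R,
  `|x.1 - y.1| < d -> `|x.2 - y.2| < d -> f x <= f y + e.
have cov : \forall d \near (0:R)^'+, K `<=` P d.
  apply: (iffLR (compact_near_coveringP K) cK) => x Kx.
  have dx : disc 1 x by rewrite /disc /= expr1n; exact: le_lt_trans Kx r21.
  have /cvgrPdist_lt/(_ _ e20) := fc x dx.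
  move=> /nbhs_ballP[r /= rr hr].
  have r20 : 0 < r / 2 by exact: divr_gt0.
  near=> x' d => y /= y1 y2.
  have dr : d < r / 2 by near: d; exact: nbhs_right_lt.
  have bx : ball x (r / 2) x' by near: x'; exact: nbhsx_ballx.
  have h1 : `|f x - f x'| < e / 2.
    by apply: hr; apply: le_ball bx; rewrite ler_pdivrMr// ler_peMr// ltW// ltr1n.
  have h2 : `|f x - f y| < e / 2.
    apply: hr; rewrite (splitr r); apply: ball_triangle bx _.
    by split => /=; rewrite /ball /=; [apply: lt_trans y1 _|apply: lt_trans y2 _].
  move: h1 h2; rewrite !ltr_norml => /andP[h1 h2] /andP[h3 h4].
  by lra.
have [d [d0 hd]] : exists d, 0 < d /\ K `<=` P d.
  have [d hd] := @filter_ex _ _ _ _ (filterI (nbhs_right_gt (0:R)) cov).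
  by exists d; split; [exact: hd.1|exact: hd.2].
by exists d => // x y Kx; exact: hd.
Unshelve. all: by end_near. Qed.

Lemma sqnorm_le_coord (r : R) (x : R * R) : 0 <= r -> sqnorm x <= r ^+ 2 ->
  (- r <= x.1 <= r) /\ (- r <= x.2 <= r).
Proof.
move=> r0; rewrite /sqnorm => xr.
have one (b c : R) : b ^+ 2 + c ^+ 2 <= r ^+ 2 -> - r <= b <= r.
  move=> bc; rewrite -ler_norml -(@ler_pXn2r _ 2) ?nnegrE// real_normK ?num_real//.
  by apply: le_trans bc; rewrite lerDl sqr_ge0.
by split; [exact: one xr|apply: (one _ x.1); rewrite addrC].
Qed.

Lemma sqnorm_near (h : R) (x z : R * R) : 0 <= h -> h <= 1 -> sqnorm x <= 1 ->
  `|x.1 - z.1| <= h -> `|x.2 - z.2| <= h -> sqnorm z <= sqnorm x + 6 * h.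
Proof.
move=> h0 h1 x1.
have one (b c : R) : -1 <= b <= 1 -> `|b - c| <= h -> c ^+ 2 <= b ^+ 2 + 3 * h.
  rewrite -ler_norml => b1; rewrite distrC => bc.
  have -> : c ^+ 2 = b ^+ 2 + (c - b) * (2 * b) + (c - b) ^+ 2 by ring.
  have d1 : (c - b) ^+ 2 <= h.
    rewrite -(real_normK (num_real (c - b))); apply: (@le_trans _ _ (h ^+ 2)).
      by apply: lerXn2r; rewrite ?nnegrE.
    by rewrite expr2 ler_piMl.
  have d2 : (c - b) * (2 * b) <= 2 * h.
    apply: (le_trans (ler_norm _)); rewrite normrM mulrC; apply: ler_pM => //.
    by rewrite normrM ger0_norm// ler_piMr.
  by move: d1 d2; lra.
have [b1 b2] := @sqnorm_le_coord 1 x ler01 ltac:(by rewrite expr1n).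
by move=> /(one _ _ b1) q1 /(one _ _ b2) q2; rewrite /sqnorm; lra.
Qed.

(** Masses are taken from a lower sum, so their total never exceeds the norm; the kernel reproduces
    [f] up to the factor [kappa] because its discrete mass is nearly 1. *)
Lemma discretization f (r1 r2 eta kappa eps0 : R) :
  (forall x, 0 <= f x) -> (forall x, disc 1 x -> {for x, continuous f}) ->
  (@lebesgue2 R).-integrable (@unit_disc R) (fun x => (f x)%:E) ->
  0 < r1 -> r1 < r2 -> r2 < 1 -> 0 < eta -> 1 < kappa -> 0 < eps0 ->
  exists (l : seq (nat * nat)) (y : nat * nat -> R * R) (c : nat * nat -> R) (eps : R),
    [/\ 0 < eps <= eps0, forall p, sqnorm (y p) <= r2 ^+ 2, forall p, 0 <= c p,
      \sum_(p <- l) c p <= L1norm f &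
      forall x, disc r1 x ->
        f x <= kappa * (\sum_(p <- l) c p * kernel eps (x.1 - (y p).1) (x.2 - (y p).2)) + eta].
Proof.
move=> f0 fc fi r10 r12 r21 eta0 kap1 eps00.
have r20 : 0 < r2 by exact: lt_trans r12.
have eta20 : 0 < eta / 2 by exact: divr_gt0.
have [d d0 hd] := unif_continuous_disc (ltW r20) r21 eta20 fc.
(* A seventh root, so that the loss [a ^+ 7] is at most [kappa]. *)
pose a := Num.min 2 (kappa `^ (7%:R^-1)).
have kap0 : 0 < kappa by exact: lt_trans kap1.
have a1 : 1 < a.
  rewrite lt_min ltr1n/= -(powRr0 kappa) /powR gt_eqF// mul0r expR0.
  by rewrite expR_gt1 mulr_gt0 ?invr_gt0 ?ln_gt0.
have a2 : a <= 2 by rewrite ge_min lexx.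
have a0 : 0 < a by exact: lt_trans a1.
have a7 : a ^+ 7 <= kappa.
  apply: (@le_trans _ _ ((kappa `^ (7%:R^-1)) ^+ 7)).
    by apply: lerXn2r; rewrite ?nnegrE ?powR_ge0 ?(ltW a0)// ge_min lexx orbT.
  by rewrite -powR_mulrn ?powR_ge0// -powRrM mulVf ?pnatr_eq0// powRr1// ltW.
have gap : 0 < r2 ^+ 2 - r1 ^+ 2 by rewrite subr_gt0 ltr_pXn2r ?nnegrE ?ltW.
pose h := Num.min (d / 2) (Num.min ((r2 ^+ 2 - r1 ^+ 2) / 12) (1 - r2)).
have h0 : 0 < h by rewrite !lt_min !divr_gt0// subr_gt0.
have hd2 : h < d by rewrite gt_min ltr_pdivrMr// ltr_pMr// ltr1n.
have h12 : 12 * h <= r2 ^+ 2 - r1 ^+ 2.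
  have : h <= (r2 ^+ 2 - r1 ^+ 2) / 12 by rewrite !ge_min lexx !orbT.
  by lra.
have hr2 : h <= 1 - r2 by rewrite !ge_min lexx !orbT.
have [eps epsb [s0 s00 mass]] := kernel_mass a1 a2 h0 eps00.
pose s' := Num.min s0 h.
have s'0 : 0 < s' by rewrite lt_min s00.
pose N := (Num.trunc (2 / s')).+1.
have N0 : 0 < N%:R :> R by rewrite ltr0n.
pose s := 2 / N%:R : R.
have sp : 0 < s by rewrite divr_gt0.
have ss' : s <= s'.
  by rewrite /s ler_pdivrMr// mulrC -ler_pdivrMr// ltW// truncnS_gt.
have ss0 : s <= s0 by rewrite (le_trans ss')// ge_min lexx.
have sh : s <= h by rewrite (le_trans ss')// ge_min lexx orbT.
have Ns : -1 + N%:R * s = 1 by rewrite /s mulrCA mulfV ?lt0r_neq0//; lra.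
(* Moving by [h] changes the squared norm by at most [6 * h]; [12 * h <= r2 ^+ 2 - r1 ^+ 2] makes
   every corner within [h] of the disc of radius [r1] good. *)
pose good p := sqnorm (grid s p) + 6 * h <= r2 ^+ 2.
have r22 : r2 ^+ 2 < 1 by rewrite expr_lt1// ltW.
have r2r2 : r2 ^+ 2 <= r2 by rewrite expr2 ler_piMl// ltW.
have hle1 : h <= 1 by rewrite (le_trans hr2)// gerBl ltW.
have sq_near x z : sqnorm x <= 1 ->
    `|x.1 - z.1| <= h -> `|x.2 - z.2| <= h -> sqnorm z <= sqnorm x + 6 * h.
  exact: sqnorm_near (ltW h0) hle1.
pose l := [seq p <- [seq (i, j) | j <- iota 0 N, i <- iota 0 N] | good p].
(* Half of [eta] puts the sample below [f] on its square; the other half covers the oscillation from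
   [x] to the corner. *)
pose c' p := Num.max (f (grid s p) - eta / 2) 0.
pose c p := if good p then c' p * s ^+ 2 else 0.
pose y p := if good p then grid s p else 0.
have s20 : 0 <= s ^+ 2 by rewrite sqr_ge0.
have c'0 p : 0 <= c' p by rewrite le_max lexx orbT.
have c0 p : 0 <= c p by rewrite /c; case: ifP => // _; exact: mulr_ge0.
have good_le p : good p -> sqnorm (grid s p) <= r2 ^+ 2.
  by rewrite /good; clear -h0; lra.
have goodl p : p \in l -> good p by rewrite mem_filter => /andP[].
have sq_dist p z : square s p z ->
    `|(grid s p).1 - z.1| <= h /\ `|(grid s p).2 - z.2| <= h.
  move=> [/=]; rewrite !in_itv /= => /andP[q1 q2] /andP[q3 q4].
  by clear -q1 q2 q3 q4 sh h0; rewrite !ler_norml; split; apply/andP; split; lra.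
exists l, y, c, eps; split => //.
- move=> p; rewrite /y; case: ifP => [/good_le//|_].
  by rewrite /sqnorm /= !expr2 !mulr0 addr0 mulr_ge0// ltW.
- rewrite (_ : \sum_(p <- l) c p = \sum_(p <- l) c' p * s ^+ 2); last first.
    by rewrite big_seq [RHS]big_seq; apply: eq_bigr => p /goodl gp; rewrite /c gp.
  apply: sum_squares_le => //.
  + rewrite filter_uniq// allpairs_uniq ?iota_uniq// => -[? ?] [? ?] _ _ /= [-> ->]//.
  + move=> p /goodl gp z /sq_dist[z1 z2]; apply/unit_discE.
    rewrite /disc /= expr1n; apply: (le_lt_trans (sq_near _ _ _ z1 z2)).
      by apply: (le_trans (good_le _ gp)); exact: ltW.
    exact: le_lt_trans gp r22.
  + move=> p z /goodl gp /sq_dist[z1 z2]; rewrite ge_max f0 andbT lerBlDr.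
    by apply: hd; [exact: good_le|exact: le_lt_trans z1 hd2|exact: le_lt_trans z2 hd2].
move=> x dx; rewrite -lerBlDr.
have sum0 : 0 <= \sum_(p <- l) c p * kernel eps (x.1 - (y p).1) (x.2 - (y p).2).
  by apply: sumr_ge0 => p _; rewrite mulr_ge0// kernel_ge0.
have [F0|F0] := leP (f x - eta) 0.
  by apply: (le_trans F0); rewrite mulr_ge0// ltW.
have r11 : r1 ^+ 2 <= r2 ^+ 2 by clear -gap; lra.
have x2 : sqnorm x <= r2 ^+ 2 by rewrite (le_trans (ltW dx)).
have [/andP[xa xb] /andP[xc xd]] := sqnorm_le_coord (ltW r20) x2.
have := mass s x.1 x.2 N sp ss0; rewrite Ns.
have lo (b : R) : - r2 <= b -> -1 <= b - h by clear -hr2; lra.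
have hi (b : R) : b <= r2 -> b + h <= 1 by clear -hr2; lra.
move=> /(_ (lo _ xa) (hi _ xb) (lo _ xc) (hi _ xd)).
set M := \sum_(0 <= j < N | _) _ => hM.
have M0 : 0 <= M.
  apply: sumr_ge0 => j _; apply: sumr_ge0 => i _.
  by rewrite mulr_ge0 ?kernel_ge0// mulr_ge0// ltW.
have h1 : f x - eta <= kappa * ((f x - eta) * M).
  rewrite mulrCA -[leLHS]mulr1 ler_pM2l//; apply: (le_trans hM).
  by rewrite ler_wpM2r.
apply: (le_trans h1); rewrite ler_pM2l// /l big_filter big_mkcond.
rewrite big_allpairs_dep /= mulr_sumr /index_iota !subn0 big_mkcond /=.
apply: ler_sum => j _.
have term0 (p : nat * nat) : 0 <= (if good p then
    c p * kernel eps (x.1 - (y p).1) (x.2 - (y p).2) else 0).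
  by case: ifP => // _; rewrite mulr_ge0// kernel_ge0.
case: ifP => [jh|_]; last by apply: sumr_ge0 => i _; exact: term0.
rewrite mulr_sumr big_mkcond /=; apply: ler_sum => i _.
case: ifP => [ih|_]; last exact: term0.
have g : good (i, j).
  have := sq_near x (grid s (i, j)) _ _ _.
  rewrite /grid /= distrC ih distrC jh => /(_ _ isT isT) hx.
  rewrite /good; have := hx (le_trans x2 (ltW r22)); rewrite /grid /=.
  by clear -dx h12; move: dx; rewrite /disc /=; lra.
rewrite g /c /y g.
have fx : f x - eta <= c' (i, j).
  have : f x <= f (grid s (i, j)) + eta / 2.
    apply: hd => //=; rewrite distrC; exact: le_lt_trans hd2.
  by rewrite /c' le_max; move=> q; apply/orP; left; clear -q; lra.
rewrite /grid /= -(opprB (x.1)) -(opprB (x.2)) /kernel !sqrrN -/(kernel _ _ _).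
rewrite [leLHS]mulrA; apply: ler_wpM2r; first exact: kernel_ge0.
by rewrite -expr2 ler_wpM2r.
Qed.
End GridSum.

(** * From smooth solutions to regular flows *)

Section LineDerivative.
Variables (R : realType) (V : normedModType R).
Implicit Types (f : V -> R) (v p : V) (r : R).

Lemma line_quotient f v p r :
  (fun h : R => h^-1 *: (((fun r : R => f (r *: v + p)) \o shift r) (h *: 1) - f (r *: v + p))) =
  (fun h : R => h^-1 *: ((f \o shift (r *: v + p)) (h *: v) - f (r *: v + p))).
Proof.
apply/funext => h /=; congr (_ *: (f _ - _)).
by rewrite [h *: 1]mulr1 scalerDl addrA.
Qed.

Lemma derive_line f v p r : 'D_1 (fun r : R => f (r *: v + p)) r = 'D_v f (r *: v + p).
Proof. by rewrite /derive line_quotient. Qed.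

Lemma is_derive_line f v p r : derivable f (r *: v + p) v ->
  is_derive r (1:R) (fun r : R => f (r *: v + p)) ('D_v f (r *: v + p)).
Proof.
move=> df; apply: DeriveDef; last exact: derive_line.
by move: df; rewrite /derivable line_quotient.
Qed.

Lemma second_derivative_derive f v p a :
  second_derivative (fun r : R => f (r *: v + p)) a -> 'D_v ('D_v f) p = a.
Proof.
move=> [g1 [ng dg]].
have -> : 'D_v ('D_v f) p = 'D_1 (fun r : R => 'D_v f (r *: v + p)) 0.
  by rewrite (derive_line ('D_v f)) scale0r add0r.
rewrite (@near_eq_derive _ _ _ _ g1); first exact: (@derive_val _ _ _ _ _ _ _ dg).
near=> r.
have h : is_derive r (1:R) (fun r : R => f (r *: v + p)) (g1 r) by near: r.
by rewrite -(derive_line f); exact: (@derive_val _ _ _ _ _ _ _ h).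
Unshelve. all: by end_near. Qed.

End LineDerivative.

Section Smooth.
Variable R : realType.
Implicit Types (x y : R * R) (f g : R * R -> R) (s t : R).

Lemma line1 x (r : R) : (x.1 + r, x.2) = r *: ((1, 0) : R * R) + x.
Proof. by case: x => a b; congr (_, _); rewrite /= ?[_ *: 1]mulr1 ?[_ *: 0]mulr0 ?add0r// addrC. Qed.

Lemma line2 x (r : R) : (x.1, x.2 + r) = r *: ((0, 1) : R * R) + x.
Proof. by case: x => a b; congr (_, _); rewrite /= ?[_ *: 1]mulr1 ?[_ *: 0]mulr0 ?add0r// addrC. Qed.

Lemma laplacian_eq f x l : has_laplacian f x l -> laplacian f x = l.
Proof.
move=> [a [b [ha hb ->]]]; rewrite /laplacian.
congr (_ + _); apply: second_derivative_derive.
  by move: ha; under [fun r => f (_ + r, _)]eq_fun do rewrite line1.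
by move: hb; under [fun r => f (_, _ + r)]eq_fun do rewrite line2.
Qed.

Lemma second_derivative_ln (g g1 : R -> R) (a : R) :
  (\forall r \near (0:R), 0 < g r) ->
  (\forall r \near (0:R), is_derive r (1:R) g (g1 r)) -> is_derive (0:R) (1:R) g1 a ->
  exists b, second_derivative (fun r => ln (g r)) b.
Proof.
move=> gpos dg dg1.
have g00 : 0 < g 0 by exact: nbhs_singleton gpos.
have dg0 := nbhs_singleton dg.
eexists; exists (fun r => (g r)^-1 * g1 r); split.
  near=> r.
  apply: (@is_derive1_comp _ (@ln R) g).
    by apply: is_derive1_ln; near: r.
  by near: r.
apply: (@is_deriveM _ _ (fun r => (g r)^-1) g1).
exact: (@is_deriveV R g 0 _ 1 (lt0r_neq0 g00) dg0).
Unshelve. all: by end_near. Qed.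


Lemma Ck_on_derive (V : normedModType R) k (U : set V) (f : V -> R) v :
  Ck_on k.+1 U f -> (forall p, U p -> derivable f p v) /\ Ck_on k U ('D_v f).
Proof. by move=> [_ h]; exact: h. Qed.

Lemma Ck_on_continuous (V : normedModType R) k (U : set V) (f : V -> R) p :
  Ck_on k U f -> U p -> {for p, continuous f}.
Proof. by case: k => [|k] [h _]; exact: h. Qed.

Lemma line_cvg (V : normedModType R) (v p : V) : r *: v + p @[r --> (0:R)] --> p.
Proof.
rewrite [X in _ --> X](_ : p = 0 *: v + p); last by rewrite scale0r add0r.
apply: cvgD; last exact: cvg_cst.
by apply: cvgZl; exact: cvg_id.
Qed.

Lemma second_derivative_ln_smooth (V : normedModType R) (U : set V) (g : V -> R) (v p : V) :
  open U -> U p -> (forall k, Ck_on k U g) -> 0 < g p ->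
  exists b, second_derivative (fun r : R => ln (g (r *: v + p))) b.
Proof.
move=> oU Up gC gp.
have Unear : \forall r \near (0:R), U (r *: v + p).
  exact: (@line_cvg _ v p U (open_nbhs_nbhs (conj oU Up))).
have [d1 C1] := Ck_on_derive v (gC 2%N).
have [d2 _] := Ck_on_derive v C1.
apply: (@second_derivative_ln (fun r => g (r *: v + p)) (fun r => 'D_v g (r *: v + p))
  ('D_v ('D_v g) (0 *: v + p))).
- have gc := Ck_on_continuous (gC 0%N) Up.
  have : g (r *: v + p) @[r --> (0:R)] --> g p.
    exact: (continuous_cvg _ gc (@line_cvg _ v p)).
  by move/cvgr_gt; exact.
- near=> r; apply: is_derive_line; apply: d1.
  by near: r.
- apply: (is_derive_line (f := 'D_v g)); apply: d2.
  by rewrite scale0r add0r.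
Unshelve. all: by end_near. Qed.

Variables (T : R) (u : R * R -> R -> R).
Hypotheses
  (u_gt0 : forall (x : R * R) (t : R), unit_disc x -> 0 <= t < T -> 0 < u x t)
  (u_smooth : smooth_on (@unit_disc R `*` `[0, T[) (fun p : R * R * R => u p.1 p.2))
  (u_eq : log_diffusion T u).

Let Lam x t := laplacian (fun y => ln (u y t)) x.

(** For [t = 0] the set [U] contains negative times, where only [g] is meaningful; spacetime
    regularity is therefore read off from [g]. *)
Lemma local_extension x t : disc 1 x -> 0 <= t < T ->
  exists (U : set (R * R * R)) (g : R * R * R -> R),
    [/\ open U, U (x, t), (forall k, Ck_on k U g) &
      forall y s, U (y, s) -> disc 1 y -> 0 <= s < T -> g (y, s) = u y s].
Proof.
move=> dx tT; have [|U [g [oU Up gC gu]]] := @u_smooth (x, t : R).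
  by split; [exact/unit_discE|rewrite /= in_itv].
exists U, g; split => // y s Uy dy sT.
by apply: (gu (y, s)) => //; split; [exact/unit_discE|rewrite /= in_itv].
Qed.

Lemma has_laplacian_solution x t : disc 1 x -> 0 <= t < T ->
  has_laplacian (fun y => ln (u y t)) x (Lam x t).
Proof.
move=> dx tT; have [U [g [oU Up gC gu]]] := local_extension dx tT.
have gp : 0 < g (x, t) by rewrite gu//; apply: u_gt0 => //; exact/unit_discE.
have along (v : R * R) : exists b, second_derivative (fun r : R => ln (u (r *: v + x) t)) b.
  have [b hb] := second_derivative_ln_smooth (v, 0) oU Up gC gp.
  exists b; apply: near_eq_second_derivative hb.
  have Unear : \forall r \near (0:R), U (r *: (v, 0) + (x, t)).
    exact: (@line_cvg _ (v, 0 : R) (x, t) U (open_nbhs_nbhs (conj oU Up))).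
  have Dnear : \forall r \near (0:R), disc 1 (r *: v + x).
    exact: (@line_cvg _ v x (disc 1) (near_disc dx)).
  near=> r.
  have E : r *: (v, 0 : R) + (x, t) = (r *: v + x, t).
    by congr (_, _); rewrite /= [_ *: 0]mulr0 add0r.
  rewrite E; congr ln; apply: gu => //.
    by rewrite -E; near: r.
  by near: r.
have [a ha] := along (1, 0); have [b hb] := along (0, 1).
have hl : has_laplacian (fun y => ln (u y t)) x (a + b).
  exists a, b; split => //.
    by under [fun r => ln _]eq_fun do rewrite line1.
  by under [fun r => ln _]eq_fun do rewrite line2.
by rewrite /Lam (laplacian_eq hl).
Unshelve. all: by end_near. Qed.

Lemma solution_continuous x t : disc 1 x -> 0 <= t < T -> {for x, continuous (u ^~ t)}.
Proof.
move=> dx tT; have [U [g [oU Up gC gu]]] := local_extension dx tT.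
have gc := Ck_on_continuous (gC 0%N) Up.
have c : (y, t) @[y --> x] --> (x, t).
  by apply: (@cvg_pair _ _ _ _ (nbhs x) (nbhs t)); [exact: cvg_id|exact: cvg_cst].
have Unear : \forall y \near x, U (y, t) by exact: (c U (open_nbhs_nbhs (conj oU Up))).
rewrite /prop_for /continuous_at -[X in _ --> X](gu x t)//.
apply: cvg_trans (continuous_cvg _ gc c).
apply: near_eq_cvg; near=> y; rewrite /= gu//.
  by near: y.
by near: y; exact: near_disc.
Unshelve. all: by end_near. Qed.

(** Limits from the right are available at [t = 0] as well, and their uniqueness identifies Delta ln
    u with the time derivative of [g]. The Laplacian thereby inherits continuity from [g]. *)
Lemma time_derivative x t (U : set (R * R * R)) (g : R * R * R -> R) :
  open U -> U (x, t) -> (forall k, Ck_on k U g) ->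
  (forall y s, U (y, s) -> disc 1 y -> 0 <= s < T -> g (y, s) = u y s) ->
  disc 1 x -> 0 <= t < T -> Lam x t = 'D_((0, 0), 1) g (x, t).
Proof.
move=> oU Up gC gu dx /andP[t0 tT].
pose e3 : R * R * R := ((0, 0), 1).
have Ee (s : R) : s *: e3 + (x, 0) = (x, s).
  by case: (x) => a b; rewrite /e3; congr ((_, _), _); rewrite /= ?[_ *: 1]mulr1 ?[_ *: 0]mulr0 ?add0r ?addr0.
have [d1 _] := Ck_on_derive e3 (gC 1%N).
have dg : is_derive t (1:R) (fun s => g (s *: e3 + (x, 0))) ('D_e3 g (x, t)).
  by rewrite -[(x, t)](Ee t); apply: is_derive_line; rewrite Ee; exact: d1.
have tin : t \in `[t, T[ by rewrite in_itv /= lexx.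
have Unear : \forall s \near t, U (x, s).
  have c : (x, s) @[s --> t] --> (x, t).
    by apply: (@cvg_pair _ _ _ _ (nbhs x) (nbhs t)); [exact: cvg_cst|exact: cvg_id].
  exact: (c U (open_nbhs_nbhs (conj oU Up))).
have shift0 : s - t @[s --> t^'+] --> (0:R)^'.
  move=> A hA.
  have /nbhs_ballP[e /= e0 he] : \forall h \near (0:R), h != 0 -> A h by exact: hA.
  suff : \forall s \near t^'+, A (s - t) by [].
  near=> s.
  have ts : t < s by near: s; exact: nbhs_right_gt.
  have se : s < t + e by near: s; apply: nbhs_right_lt; rewrite ltrDl.
  apply: he; last by rewrite subr_eq0 gt_eqF.
  by rewrite -ball_normE /= sub0r normrN gtr0_norm ?subr_gt0// ltrBlDl.
have H2 : (u x s - u x t) / (s - t) @[s --> t^'+] --> 'D_e3 g (x, t).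
  case: dg => [dg dgE].
  have := cvg_comp _ _ shift0 dg; rewrite -/(derive _ _ _) dgE.
  apply: cvg_trans; apply: near_eq_cvg; near=> s.
  have sT : 0 <= s < T.
    have ts : t < s by near: s; exact: nbhs_right_gt.
    rewrite (le_trans t0 (ltW ts)) /=; near: s; exact: nbhs_right_lt.
  have Us : U (x, s) by near: s; exact: cvg_within.
  rewrite /= [_ *: 1]mulr1 subrK !Ee !gu// ?t0//.
  by rewrite /GRing.scale /= mulrC.
have H1 : (u x s - u x t) / (s - t) @[s --> t^'+] --> Lam x t.
  have tT' : 0 <= t < T by rewrite t0.
  have := @u_eq x t; move=> /(_ _ tT') h; apply: cvg_trans (h _); last exact/unit_discE.
  apply: cvg_app => A hA.
  have {}hA : \forall s \near t, s != t -> `[0, T[%classic s -> A s by exact: hA.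
  have hT : \forall s \near t, s < T by exact: lt_nbhsl.
  suff : \forall s \near t, t < s -> A s by [].
  near=> s => ts.
  have : s != t -> `[0, T[%classic s -> A s by near: s.
  apply; first by rewrite gt_eqF.
  by rewrite /= in_itv /= (le_trans t0 (ltW ts)); near: s.
exact: (cvg_unique _ H1 H2).
Unshelve. all: by end_near. Qed.

(** Compactness of the closed cylinder makes the local bounds uniform. The Euler clause is the mean
    value theorem in time together with the small oscillation of the time derivative of [g]. *)
Lemma regular_flow_solution (rho S : R) : 0 < rho -> rho < 1 -> S < T ->
  regular_flow rho S u Lam.
Proof.
move=> rho0 rho1 ST.
pose K : set (R * R * R) := [set x | sqnorm x <= rho ^+ 2] `*` `[0, S]%classic.
have cK : compact K.
  by apply: compact_setX; [exact: (sqnorm_le_compact (ltW rho0))|exact: segment_compact].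
have rho21 : rho ^+ 2 < 1 by rewrite expr_lt1// ltW.
have d1 y : sqnorm y <= rho ^+ 2 -> disc 1 y.
  by move=> h; rewrite /disc /= expr1n; exact: le_lt_trans h rho21.
have dd y : disc rho y -> disc 1 y by move=> h; apply: d1; exact: ltW.
have st s : 0 <= s <= S -> 0 <= s < T.
  by move=> /andP[-> h]; exact: le_lt_trans h ST.
have KD y s : disc rho y -> 0 <= s <= S -> K (y, s).
  by move=> /ltW h sS; split => //=; rewrite in_itv.
pose e3 : R * R * R := ((0, 0), 1).
split.
- by move=> x t /dd dx /st; apply: u_gt0; exact/unit_discE.
- pose P (M : R) (q : R * R * R) := K q -> u q.1 q.2 <= M /\ Lam q.1 q.2 <= M.
  have cov : \forall M \near +oo, K `<=` P M.
    apply: (iffLR (compact_near_coveringP K) cK) => -[x t] [/= /d1 dx].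
    rewrite in_itv /= => /st tT; have [U [g [oU Up gC gu]]] := local_extension dx tT.
    have gc := Ck_on_continuous (gC 0%N) Up.
    have [_ C1] := Ck_on_derive e3 (gC 1%N).
    have dc := Ck_on_continuous C1 Up.
    have h1 : \forall q \near ((x, t) : R * R * R), g q < g (x, t) + 1.
      by move/cvgr_lt : gc; apply; rewrite ltrDl.
    have h2 : \forall q \near ((x, t) : R * R * R),
        'D_e3 g q < 'D_e3 g (x, t) + 1.
      by move/cvgr_lt : dc; apply; rewrite ltrDl.
    have h3 : \forall q \near ((x, t) : R * R * R), U q by exact: open_nbhs_nbhs.
    near=> q M => -[/= /d1 dq]; rewrite in_itv /= => /st sT.
    have Uq : U (q.1, q.2) by rewrite -surjective_pairing; near: q.
    rewrite (time_derivative oU Uq gC gu dq sT) -(gu _ _ Uq dq sT) -surjective_pairing.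
    have mM : Num.max (g (x, t) + 1) ('D_e3 g (x, t) + 1) <= M.
      by near: M; apply: nbhs_pinfty_ge; rewrite num_real.
    move: mM; rewrite ge_max => /andP[m1 m2].
    have q1 : g q < g (x, t) + 1 by near: q.
    have q2 : 'D_e3 g q < 'D_e3 g (x, t) + 1 by near: q.
    by split; [exact: le_trans (ltW q1) m1|exact: le_trans (ltW q2) m2].
  have [M hM] := @filter_ex _ _ _ _ cov.
  by exists M => x t dx tS; have /(_ (KD _ _ dx tS)) := hM _ (KD _ _ dx tS).
- by move=> x t /dd dx /st; exact: has_laplacian_solution.
- by move=> x t /dd dx /st; exact: solution_continuous.
move=> w w0.
pose P (d : R) (q : R * R * R) := K q -> forall s', 0 <= s' -> s' < q.2 -> q.2 - s' <= d ->
  u q.1 q.2 - u q.1 s' <= (q.2 - s') * (Lam q.1 q.2 + w).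
have cov : \forall d \near (0:R)^'+, K `<=` P d.
  apply: (iffLR (compact_near_coveringP K) cK) => -[x t] [/= /d1 dx].
  rewrite in_itv /= => /st tT; have [U [g [oU Up gC gu]]] := local_extension dx tT.
  have [der C1] := Ck_on_derive e3 (gC 1%N).
  have dc := Ck_on_continuous C1 Up.
  have w20 : 0 < w / 2 by exact: divr_gt0.
  have /nbhs_ballP[r /= r0 hr] : \forall q \near ((x, t) : R * R * R),
      U q /\ `|'D_e3 g (x, t) - 'D_e3 g q| < w / 2.
    apply: filterI; first exact: open_nbhs_nbhs.
    by move/cvgrPdist_lt : dc; apply.
  have r20 : 0 < r / 2 by exact: divr_gt0.
  near=> q d => -[/= /d1 dq]; rewrite in_itv /= => /st sT s' s'0 s'q s'd.
  have bq : ball ((x, t) : R * R * R) (r / 2) q by near: q; exact: nbhsx_ballx.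
  have dr : d < r / 2 by near: d; exact: nbhs_right_lt.
  have near_ s : s' <= s -> s <= q.2 -> ball ((x, t) : R * R * R) r (q.1, s).
    move=> s1 s2; rewrite (splitr r); apply: ball_triangle bq _.
    split; first exact: ballxx.
    by rewrite -ball_normE /= ger0_norm ?subr_ge0//; lra.
  have sT' s : s' <= s -> s <= q.2 -> 0 <= s < T.
    move=> s1 s2; rewrite (le_trans s'0 s1) /=.
    by apply: le_lt_trans s2 _; have /andP[] := sT.
  have Ee (s : R) : s *: e3 + (q.1, 0) = (q.1, s).
    by case: (q.1) => a b; rewrite /e3; congr ((_, _), _); rewrite /= ?[_ *: 1]mulr1 ?[_ *: 0]mulr0 ?add0r ?addr0.
  have dg s : s' <= s -> s <= q.2 ->
      is_derive s (1:R) (fun s => g (s *: e3 + (q.1, 0))) ('D_e3 g (q.1, s)).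
    move=> s1 s2; rewrite -[(q.1, s)](Ee s); apply: is_derive_line; rewrite Ee; apply: der.
    by have [] := hr _ (near_ _ s1 s2).
  have [||c] := @MVT_segment R (fun s => g (s *: e3 + (q.1, 0))) (fun s => 'D_e3 g (q.1, s)) s' q.2 (ltW s'q).
  - by move=> s; rewrite in_itv /= => /andP[/ltW s1 /ltW s2]; exact: dg.
  - apply: derivable_within_continuous => s; rewrite in_itv /= => /andP[s1 s2].
    by have [] := dg _ s1 s2.
  rewrite in_itv /= => /andP[c1 c2]; rewrite !Ee.
  have [Uc Dc] := hr _ (near_ _ c1 c2).
  have [Uq Dq] := hr _ (near_ _ (ltW s'q) (lexx _)).
  have [Us _] := hr _ (near_ _ (lexx _) (ltW s'q)).
  rewrite (gu _ _ Uq dq sT) (gu _ _ Us dq (sT' _ (lexx _) (ltW s'q))) => ->.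
  rewrite (time_derivative oU Uq gC gu dq sT) mulrC ler_pM2l ?subr_gt0//.
  by move: Dc Dq; rewrite !ltr_norml => /andP[? ?] /andP[? ?]; lra.
have [d hd] := @filter_ex _ _ _ _ (filterI (nbhs_right_gt (0:R)) cov).
exists d; first exact: hd.1.
move=> x s s' dx s0 ss sS sd.
have sin : 0 <= s <= S by rewrite sS (le_trans s0 (ltW ss)).
exact: (hd.2 _ (KD _ _ dx sin) (KD _ _ dx sin)).
Unshelve. all: by end_near. Qed.

End Smooth.

(** * The two smoothing steps *)

Section TwoSteps.
Variable R : realType.
Implicit Types (x : R * R).

(** Jensen, by the tangent line at the mean, with the missing weight placed at 0, where the
    exponential is 1. *)
Lemma expR_convex_sum (I : Type) (l : seq I) (th a : I -> R) :
  (forall i, 0 <= th i) -> \sum_(i <- l) th i <= 1 ->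
  expR (\sum_(i <- l) th i * a i) <= 1 + \sum_(i <- l) th i * expR (a i).
Proof.
move=> th0; set s := \sum_(i <- l) th i => s1.
set m := \sum_(i <- l) _ * a _.
have s0 : 0 <= s by apply: sumr_ge0.
have h1 : expR m * (s + m - m * s) <= \sum_(i <- l) th i * expR (a i).
  have -> : expR m * (s + m - m * s) = \sum_(i <- l) th i * (expR m * (1 + (a i - m))).
    under [RHS]eq_bigr => i _ do rewrite mulrCA mulrDr mulr1 mulrBr.
    rewrite -mulr_sumr; congr (_ * _).
    by rewrite big_split /= sumrB -mulr_suml -/s -/m; ring.
  apply: ler_sum => i _; apply: ler_wpM2l => //.
  have -> : expR (a i) = expR m * expR (a i - m) by rewrite -expRD addrC subrK.
  by rewrite ler_pM2l ?expR_gt0// expR_ge1Dx.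
have h2 : expR m * (1 - m) <= 1.
  by rewrite -ler_pdivlMl ?expR_gt0// mulr1 -expRN; exact: expR_ge1Dx.
have : (1 - s) * (expR m * (1 - m)) <= (1 - s) * 1.
  by apply: ler_wpM2l => //; rewrite subr_ge0.
move: h1; move: (expR m) => e; lra.
Qed.

Lemma radial_continuous (F : R -> R) (c sg : R) (y x : R * R) :
  (forall z, 0 < z -> {for z, continuous F}) -> 0 < c + sg * dist2 x y ->
  {for x, continuous (fun x => F (c + sg * dist2 x y))}.
Proof.
move=> Fc pos; apply: (@continuous_comp _ _ _ (fun x => c + sg * dist2 x y) F); last exact: Fc.
apply: cvgD; first exact: cvg_cst.
apply: cvgMr; rewrite /dist2; apply: cvgD; rewrite expr2; under eq_fun do rewrite expr2.
  by apply: cvgM; apply: cvgB; (exact: cvg_fst || exact: cvg_cst).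
by apply: cvgM; apply: cvgB; (exact: cvg_snd || exact: cvg_cst).
Qed.

Lemma powR_continuous (p z : R) : 0 < z -> {for z, continuous (fun z : R => z `^ p)}.
Proof.
move=> z0; apply/differentiable_continuous/derivable1_diffP.
by have [] := is_derive1_powR p z0.
Qed.

(** [A] is the barrier constant for p = 1 - q, [K0 * (alpha + N)] dominates the time and slope terms
    of both steps, and the last factor bounds exp(psi / t) in the second. *)
Definition smoothing_const (d1 : R) : R :=
  let A := 8 / (1 - (1 + d1)^-1) ^+ 2 in let K0 := 2 * (1 + d1) / (4 * pi) + 2 in
  expR 1 * (K0 + expR 1 * K0 * (2 + (17 + 4 * A))) *
    expR (expR 1 * K0 * A * (4 * pi) / d1).

Lemma smoothing_const_gt0 (d1 : R) : 0 < d1 -> 0 < smoothing_const d1.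
Proof.
move=> d10; have p0 := pi_gt0 R; have E0 : 0 < expR 1 :> R := expR_gt0 1.
rewrite /smoothing_const mulr_gt0 ?expR_gt0//.
set A := 8 / _; set K0 := _ / _ + 2.
have A0 : 0 <= A by rewrite divr_ge0 ?sqr_ge0.
have K00 : 0 < K0 by rewrite ltr_wpDl// divr_ge0// ?mulr_ge0 ?(ltW p0)//; move: d10; lra.
rewrite mulr_gt0// addr_gt0// mulr_gt0//; first exact: mulr_gt0.
by move: A0; lra.
Qed.

Section Data.
Variables (d1 rho S alpha N : R) (u Lam : R * R -> R -> R)
  (l : seq (nat * nat)) (y : nat * nat -> R * R) (c : nat * nat -> R) (eps : R).
Hypotheses (d10 : 0 < d1) (rho0 : 0 < rho) (rho1 : rho <= 1)
  (fl : regular_flow rho S u Lam) (al0 : 0 <= alpha) (N0 : 0 < N)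
  (dy : forall p, disc rho (y p)) (c0 : forall p, 0 <= c p)
  (sumc : \sum_(p <- l) c p <= N) (eps0 : 0 < eps).

Let lam := Num.sqrt (N / (alpha + N)).

Hypotheses (eps_le : forall p, eps <= lam * bdepth rho (y p))
  (u0 : forall x, disc rho x -> u x 0 <= (alpha + N / 2) * hyp rho x +
     \sum_(p <- l) c p * kernel eps (x.1 - (y p).1) (x.2 - (y p).2)).

Let t0 := (1 + d1) * N / (4 * pi).
Let tau := d1 * N / (4 * pi).
Let q := (1 + d1)^-1.
Let A := 8 / (1 - q) ^+ 2.
Let K := 17 + 4 * A.
Let K0 : R := 2 * (1 + d1) / (4 * pi) + 2.

Let sg p := (lam * bdepth rho (y p)) ^- 2.
Let e p := eps ^+ 2 * sg p.
Let S1 p x := 1 + sg p * dist2 x (y p).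
Let Se p x := e p + sg p * dist2 x (y p).

Let pi40 : 0 < 4 * pi :> R. Proof. by rewrite mulr_gt0// pi_gt0. Qed.
Let aN0 : 0 < alpha + N. Proof. by rewrite ltr_wpDl. Qed.
Let lam0 : 0 < lam. Proof. by rewrite sqrtr_gt0 divr_gt0. Qed.
Let lam2 : lam ^+ 2 = N / (alpha + N).
Proof. by rewrite sqr_sqrtr// divr_ge0// ltW. Qed.
Let lam1 : lam <= 1.
Proof.
rewrite -(@ler_pXn2r _ 2) ?nnegrE ?(ltW lam0)// expr1n lam2.
by rewrite ler_pdivrMr// mul1r lerDr.
Qed.
Let sg0 p : 0 < sg p. Proof. exact: scale_gt0. Qed.
Let e0 p : 0 < e p. Proof. by rewrite mulr_gt0// exprn_gt0. Qed.
Let e1 p : e p <= 1.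
Proof.
have D0 : 0 < lam * bdepth rho (y p) by rewrite mulr_gt0// bdepth_gt0.
rewrite /e /sg ler_pdivrMr ?exprn_gt0// mul1r.
by apply: lerXn2r; rewrite ?nnegrE ?(ltW eps0) ?(ltW D0).
Qed.
Let S10 p x : 0 < S1 p x.
Proof. by rewrite ltr_wpDr// mulr_ge0 ?dist2_ge0// ltW. Qed.
Let Se0 p x : 0 < Se p x.
Proof. by rewrite ltr_wpDr// mulr_ge0 ?dist2_ge0// ltW. Qed.
Let SeS1 p x : Se p x <= S1 p x.
Proof. by rewrite lerD2r. Qed.
Let t00 : 0 < t0. Proof. by rewrite divr_gt0// mulr_gt0// ltr_wpDl// ltW. Qed.
Let tau0 : 0 < tau. Proof. by rewrite divr_gt0// mulr_gt0. Qed.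
Let q0 : 0 < q. Proof. by rewrite invr_gt0 ltr_wpDl// ltW. Qed.
Let q1 : q < 1. Proof. by rewrite invf_lt1 ?ltrDl// ltr_wpDl// ltW. Qed.
Let A0 : 0 < A. Proof. by rewrite divr_gt0// exprn_gt0// subr_gt0. Qed.

Let th p := c p / N.
Let th0 p : 0 <= th p. Proof. by rewrite divr_ge0// ltW. Qed.
Let sumth : \sum_(p <- l) th p <= 1.
Proof. by rewrite -mulr_suml ler_pdivrMr// mul1r. Qed.

(** The first step has slope alpha + N/2 from the data plus alpha + N from the truncation; rounding
    up to 2 alpha + 2 N leaves the strict gap N/2. *)
Let B := expR 1 * (2 * t0 + (2 * alpha + 2 * N)).

Hypothesis tS : t0 + tau <= S.

(** Since t0 = N / (4 pi q), the mass [c p] enters the exponent psi / t0 as weight [th p] times q,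
    which is where the power q < 1 arises. *)
Lemma first_step x : disc rho x ->
  u x t0 <= B * hyp rho x * (1 + \sum_(p <- l) th p * (S1 p x / Se p x) `^ q).
Proof.
move=> dx.
pose psi x := \sum_(p <- l) c p * ((4 * pi)^-1 * (ln (S1 p x) - ln (Se p x))).
pose lpsi x := \sum_(p <- l) c p * ((4 * pi)^-1 *
  (4 * sg p * 1 / S1 p x ^+ 2 - 4 * sg p * e p / Se p x ^+ 2)).
have h0 := hyp_gt0 rho0 dx.
have B0 : 0 < B.
  rewrite mulr_gt0 ?expR_gt0//; move: t0 t00 => t t_gt0.
  by move: al0 N0; lra.
have key : u x t0 <= B * hyp rho x * expR (psi x / t0).
  apply: (smoothing (psi := psi) (lpsi := lpsi) (alpha := alpha + N / 2 + (alpha + N)) rho0 rho1 fl t00 _ _ _ _ _ _ _ dx).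
  - by move: tS tau0; lra.
  - by move: al0 N0; lra.
  - by move: N0; lra.
  - move=> z dz; apply: cvg_big => [|p _]; first exact: add_continuous.
    apply: cvgMr; apply: cvgMr; apply: cvgB; apply: radial_continuous => //.
    + by move=> *; exact: continuous_ln.
    + exact: S10.
    + by move=> *; exact: continuous_ln.
    + exact: Se0.
  - move=> z dz; apply: sumr_ge0 => p _; rewrite !mulr_ge0 ?invr_ge0 ?(ltW pi40)//.
    by rewrite subr_ge0 ler_ln ?posrE// S10.
  - move=> z dz; apply: has_laplacian_sum => p; do 2 apply: has_laplacianZ.
    by apply: has_laplacianB; apply: has_laplacian_ln; [exact: S10|exact: Se0].
  - move=> z dz; have hz := hyp_gt0 rho0 dz.
    have lb : lpsi z <= \sum_(p <- l) c p * (hyp rho z / lam ^+ 2 -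
        kernel eps (z.1 - (y p).1) (z.2 - (y p).2)).
      apply: ler_sum => p _; apply: ler_wpM2l => //; rewrite mulrC.
      exact: (log_kernel_laplacian rho0 lam0 lam1 (dy p) dz eps0 erefl).
    have : \sum_(p <- l) c p * (hyp rho z / lam ^+ 2) <= (alpha + N) * hyp rho z.
      rewrite -mulr_suml; apply: (@le_trans _ _ (N * (hyp rho z / lam ^+ 2))).
        by rewrite ler_wpM2r// divr_ge0 ?sqr_ge0// ltW.
      rewrite lam2 invf_div mulrCA [_ * (_ / N)]mulrCA mulfV ?lt0r_neq0// mulr1.
      by rewrite mulrC.
    have E : \sum_(p <- l) c p * (hyp rho z / lam ^+ 2 -
        kernel eps (z.1 - (y p).1) (z.2 - (y p).2)) =
      \sum_(p <- l) c p * (hyp rho z / lam ^+ 2) -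
      \sum_(p <- l) c p * kernel eps (z.1 - (y p).1) (z.2 - (y p).2).
      by rewrite -sumrB; apply: eq_bigr => p _; rewrite mulrBr.
    by have := u0 dz; move: lb; rewrite E; lra.
apply: (le_trans key); rewrite ler_pM2l; last exact: mulr_gt0.
have -> : psi x / t0 = \sum_(p <- l) th p * (q * (ln (S1 p x) - ln (Se p x))).
  rewrite mulr_suml; apply: eq_bigr => p _.
  rewrite /th /q /t0; move: (4 * pi) pi40 => k k0.
  field; rewrite !lt0r_neq0//.
  by rewrite ltr_wpDr// ltW.
apply: (le_trans (expR_convex_sum _ _ _)) => //.
rewrite lerD2l; apply: ler_sum => p _; apply: ler_wpM2l => //.
by rewrite -ln_div ?posrE// /powR gt_eqF ?divr_gt0.
Qed.


(** The barrier, summed with weights [B * th p], turns the first bound into the hypothesis of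
    [smoothing] for the flow restarted at [t0], with slope [B * (1 + K)]. *)
Lemma second_step x : disc rho x ->
  u x (t0 + tau) <= smoothing_const d1 * (alpha + N) * hyp rho x.
Proof.
move=> dx; rewrite /smoothing_const -/q -/A -/K0 -/K.
have h0 := hyp_gt0 rho0 dx.
have B0 : 0 < B.
  rewrite mulr_gt0 ?expR_gt0//; move: t0 t00 => t t_gt0.
  by move: al0 N0; lra.
have E0 : 0 < expR 1 :> R := expR_gt0 1.
have K00 : 0 < K by rewrite /K; move: A0; lra.
have p0 : 0 < 1 - q by rewrite subr_gt0.
have p1 : 1 - q < 1 by rewrite gtrDl oppr_lt0.
have qq : 1 - (1 - q) = q by rewrite opprB addrC subrK.
pose Psi x := \sum_(p <- l) (B * th p) * (A * lam ^+ 2 * (S1 p x `^ (1 - q) - Se p x `^ (1 - q))).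
pose lap p x := 4 * sg p * ((1 - q) ^+ 2 * S1 p x `^ (1 - q - 1)
      + (1 - q) * (1 - (1 - q)) * 1 * S1 p x `^ (1 - q - 2)) -
   4 * sg p * ((1 - q) ^+ 2 * Se p x `^ (1 - q - 1)
      + (1 - q) * (1 - (1 - q)) * e p * Se p x `^ (1 - q - 2)).
pose lPsi x := \sum_(p <- l) (B * th p) * (A * lam ^+ 2 * lap p x).
have AL0 : 0 <= A * lam ^+ 2 by rewrite mulr_ge0 ?sqr_ge0// ltW.
have Bth p : 0 <= B * th p by rewrite mulr_ge0// ltW.
have gap p z : 0 <= S1 p z `^ (1 - q) - Se p z `^ (1 - q) <= 1.
  by apply: powR_gap => //; rewrite /S1 /Se addrAC lerD2r lerDr ltW.
have Psi_le : Psi x <= B * (A * lam ^+ 2).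
  apply: (@le_trans _ _ (\sum_(p <- l) (B * th p) * (A * lam ^+ 2))).
    apply: ler_sum => p _; apply: ler_wpM2l => //.
    by rewrite ler_piMr//; have /andP[] := gap p x.
  rewrite -mulr_suml -mulr_sumr; apply: ler_wpM2r => //.
  by rewrite ler_piMr//; exact: ltW.
have tS' : t0 <= S by move: tS tau0; lra.
have fl' := regular_flow_shift (ltW t00) fl.
have key : u x (t0 + tau) <=
    expR 1 * (2 * tau + B * (2 + K)) * hyp rho x * expR (Psi x / tau).
  apply: (smoothing (psi := Psi) (lpsi := lPsi) (alpha := B * (1 + K)) rho0 rho1 fl' tau0 _ _ _ _ _ _ _ dx).
  - by move: tS; lra.
  - by rewrite mulr_ge0 ?ltW// addr_gt0.
  - by rewrite ltr_pM2l// ltrD2r ltr1n.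
  - move=> z dz; apply: cvg_big => [|p _]; first exact: add_continuous.
    have pc (z' : R) : 0 < z' -> {for z', continuous (fun z => z `^ (1 - q))}.
      exact: powR_continuous.
    apply: cvgMr; apply: cvgMr; apply: cvgB.
      exact: (radial_continuous pc (S10 p z)).
    exact: (radial_continuous pc (Se0 p z)).
  - move=> z dz; apply: sumr_ge0 => p _; apply: mulr_ge0 => //; apply: mulr_ge0 => //.
    by have /andP[] := gap p z.
  - move=> z dz; apply: has_laplacian_sum => p.
    apply: (has_laplacianZ (B * th p)); apply: (has_laplacianZ (A * lam ^+ 2)).
    apply: has_laplacianB; first exact: (has_laplacian_powR (1 - q) (S10 p z)).
    exact: (has_laplacian_powR (1 - q) (Se0 p z)).
  - move=> z dz; have hz := hyp_gt0 rho0 dz; rewrite addr0.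
    have h1 := first_step dz.
    have h2 : \sum_(p <- l) (B * th p) * (hyp rho z * (S1 p z / Se p z) `^ q + A * lam ^+ 2 * lap p z)
       <= B * K * hyp rho z.
      apply: (@le_trans _ _ (\sum_(p <- l) (B * th p) * (K * hyp rho z))).
        apply: ler_sum => p _; apply: ler_wpM2l => //.
        have := barrier rho0 lam0 lam1 (dy p) dz p0 p1 (e0 p) (e1 p) erefl erefl erefl.
        by rewrite /lap qq; apply.
      have Kh : 0 <= K * hyp rho z by rewrite mulr_ge0// ltW.
      rewrite -mulr_suml -mulr_sumr -[leRHS]mulrA ler_wpM2r//.
      by rewrite ler_piMr// ltW.
    have E : \sum_(p <- l) (B * th p) * (hyp rho z * (S1 p z / Se p z) `^ q + A * lam ^+ 2 * lap p z)
      = B * hyp rho z * (\sum_(p <- l) th p * (S1 p z / Se p z) `^ q) + lPsi z.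
      rewrite /lPsi mulr_sumr -big_split /=; apply: eq_bigr => p _; ring.
    by move: h1 h2; rewrite E; lra.
have c40 := pi40.
have aN := aN0.
have K0E : 2 * t0 + (2 * alpha + 2 * N) <= K0 * (alpha + N) /\ 2 * tau <= K0 * (alpha + N).
  have E1 : 2 * t0 = 2 * (1 + d1) / (4 * pi) * N by rewrite /t0; ring.
  have E2 : 2 * tau = 2 * d1 / (4 * pi) * N by rewrite /tau; ring.
  have w0 : 0 <= 2 * (1 + d1) / (4 * pi) by apply: divr_ge0; move: d10 c40; lra.
  have w1 : 2 * d1 / (4 * pi) <= 2 * (1 + d1) / (4 * pi).
    by rewrite ler_pM2r ?invr_gt0//; lra.
  rewrite /K0 E1 E2; move: (2 * (1 + d1) / _) w0 w1 => w w0.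
  move: (2 * d1 / _) => w' w1.
  have a1 : 0 <= w * alpha by exact: mulr_ge0.
  have a2 : w' * N <= w * N by rewrite ler_pM2r.
  by split; move: al0 N0 a1 a2; lra.
have [K0E1 K0E2] := K0E.
have BE : B <= expR 1 * K0 * (alpha + N).
  by rewrite /B -mulrA ler_pM2l.
(* The choice of [lam] pays off: (alpha + N) lam^2 = N cancels against [tau], leaving a constant
   free of alpha and N. *)
have Ptau : Psi x / tau <= expR 1 * K0 * A * (4 * pi) / d1.
  rewrite ler_pdivrMr//; apply: (le_trans Psi_le).
  apply: (@le_trans _ _ (expR 1 * K0 * (alpha + N) * (A * lam ^+ 2))).
    by rewrite ler_wpM2r.
  rewrite lam2 /tau le_eqVlt; apply/orP; left; apply/eqP.
  move: (4 * pi) c40 (expR 1) (A) (K0) => k k0 E A' K'.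
  by field; rewrite !lt0r_neq0.
have K00' : 0 < K0 by rewrite -(pmulr_lgt0 _ aN); apply: lt_le_trans K0E2; rewrite mulr_gt0.
have fin : 2 * tau + B * (2 + K) <= (K0 + expR 1 * K0 * (2 + K)) * (alpha + N).
  have : B * (2 + K) <= expR 1 * K0 * (alpha + N) * (2 + K).
    by rewrite ler_pM2r// addr_gt0.
  by move: K0E2; lra.
have X0 : 0 <= 2 * tau + B * (2 + K).
  apply: addr_ge0; first by apply: mulr_ge0 => //; exact: ltW.
  by apply: mulr_ge0; [exact: ltW|move: K00; lra].
apply: (le_trans key).
move: (2 * tau + B * (2 + K)) X0 fin => X X0 fin.
have Eh : 0 <= expR 1 * hyp rho x by rewrite mulr_ge0 ?(ltW E0) ?(ltW h0).
have Xe : X * expR (Psi x / tau) <= (K0 + expR 1 * K0 * (2 + K)) * (alpha + N) *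
    expR (expR 1 * K0 * A * (4 * pi) / d1).
  by apply: ler_pM => //; rewrite ler_expR.
move: (ler_wpM2l Eh Xe); move: (expR (_ / tau)) (expR (_ / d1)) => E1 E2.
by congr (_ <= _); ring.
Qed.

End Data.
End TwoSteps.

(** * The limit *)

Section Main.
Variable R : realType.

Lemma hyp_factorE : @hyp_factor R = hyp 1.
Proof.
apply/funext => x; rewrite /hyp_factor /hyp /enorm sqr_sqrtr; last exact: sqnorm_ge0.
by rewrite mulr1 expr1n.
Qed.

(** Domain monotonicity of the hyperbolic metric; it carries the hypothesis on the initial data over
    to the smaller disc. *)
Lemma hyp1_le (rho : R) x : 0 < rho -> rho <= 1 -> disc rho x -> hyp 1 x <= hyp rho x.
Proof.
move=> r0 r1 dx; have s0 := sqnorm_ge0 x.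
have D : 0 < rho ^+ 2 - sqnorm x by rewrite subr_gt0.
have r2 : rho ^+ 2 <= 1 by rewrite expr_le1// ltW.
have D1 : 0 < 1 - sqnorm x by move: D r2; lra.
rewrite /hyp expr1n mulr1; apply: lerXn2r; rewrite ?nnegrE.
- by rewrite divr_ge0 ?(ltW D1).
- by rewrite divr_ge0 ?(ltW D) ?mulr_ge0 ?(ltW r0).
rewrite ler_pdivlMr// mulrAC ler_pdivrMr// -!mulrA ler_pM2l//.
rewrite -subr_ge0.
have -> : rho * (1 - sqnorm x) - (rho ^+ 2 - sqnorm x) = (1 - rho) * (rho + sqnorm x) by ring.
by rewrite mulr_ge0// ?subr_ge0// addr_ge0// ltW.
Qed.

Lemma hyp_continuous (x : R * R) : disc 1 x -> {for x, continuous (@hyp R 1)}.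
Proof.
rewrite /disc /= expr1n => dx.
have D0 : 1 ^+ 2 - sqnorm x != 0 by rewrite expr1n lt0r_neq0// subr_gt0.
have c : (2 * 1 / (1 ^+ 2 - sqnorm y)) @[y --> x] --> 2 * 1 / (1 ^+ 2 - sqnorm x).
  apply: cvgMr; apply: cvgV => //; apply: cvgB; first exact: cvg_cst.
  exact: sqnorm_continuous.
rewrite /prop_for /continuous_at /hyp; under eq_fun do rewrite expr2.
by rewrite expr2; apply: cvgM.
Qed.

Lemma hyp_cvg_left (x : R * R) : disc 1 x -> hyp rho x @[rho --> (1:R)^'-] --> hyp 1 x.
Proof.
rewrite /disc /= expr1n => dx; apply: cvg_at_left_filter.
have D0 : 1 ^+ 2 - sqnorm x != 0 by rewrite expr1n lt0r_neq0// subr_gt0.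
have c : (2 * rho / (rho ^+ 2 - sqnorm x)) @[rho --> (1:R)] --> 2 * 1 / (1 ^+ 2 - sqnorm x).
  apply: cvgM; first by apply: cvgMr; exact: cvg_id.
  apply: cvgV => //; apply: cvgB; last exact: cvg_cst.
  by rewrite expr2; under eq_fun do rewrite expr2; apply: cvgM; exact: cvg_id.
by rewrite /hyp; under eq_fun do rewrite expr2; rewrite expr2; apply: cvgM.
Qed.

Lemma near_disc_left (x : R * R) : disc 1 x -> \forall rho \near (1:R)^'-, disc rho x.
Proof.
move=> dx; have c : rho ^+ 2 @[rho --> (1:R)] --> (1:R) ^+ 2.
  by rewrite expr2; under eq_fun do rewrite expr2; apply: cvgM; exact: cvg_id.
by have /cvgr_gt/(_ _ dx) := cvg_at_left_filter c.
Qed.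

(** * Estimates for a given solution on the unit disc *)

Section Solution.
Variables (T : R) (u : R * R -> R -> R) (alpha : R).
Hypotheses (T0 : 0 < T)
  (u_gt0 : forall (x : R * R) (t : R), unit_disc x -> 0 <= t < T -> 0 < u x t)
  (u_smooth : smooth_on (@unit_disc R `*` `[0, T[) (fun p : R * R * R => u p.1 p.2))
  (u_eq : log_diffusion T u) (al0 : 0 <= alpha)
  (u_int : (@lebesgue2 R).-integrable (@unit_disc R)
     (fun x => (excess alpha (u ^~ 0) x)%:E)).

Let f := excess alpha (u ^~ 0).
Let N := L1norm f.

Let f_ge0 x : 0 <= f x. Proof. by rewrite le_max lexx orbT. Qed.

Let N_ge0 : 0 <= N.
Proof. by rewrite /N /L1norm /Rintegral fine_ge0// integral_ge0. Qed.

Let f_cont x : disc 1 x -> {for x, continuous f}.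
Proof.
move=> dx; apply: (@continuous_max _ _ (fun x => u x 0 - alpha * hyp_factor x) (fun=> 0)).
  apply: cvgB; first by apply: (solution_continuous u_smooth dx); rewrite lexx.
  by apply: cvgMr; rewrite hyp_factorE; exact: hyp_continuous.
exact: cvg_cst.
Qed.

(** Replacing N by N + e makes the mass positive and leaves room for the factor lost in the
    discretization. *)
Lemma bound_at_radius (d1 e rho t : R) x :
  0 < d1 -> 0 < e -> 0 < rho -> rho < 1 -> 0 < t -> t < T ->
  (1 + 2 * d1) * (N + e) / (4 * pi) <= t -> disc rho x ->
  u x t <= (2 * t + smoothing_const d1 * (alpha + (N + e)) + e) * hyp rho x.
Proof.
move=> d10 e0 rho0 rho1 t0 tT; set N' := N + e => tN dx.
have N'0 : 0 < N' by rewrite ltr_wpDl.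
have pi40 : 0 < 4 * pi :> R by rewrite mulr_gt0// pi_gt0.
have fl := regular_flow_solution u_gt0 u_smooth u_eq rho0 rho1 tT.
have C0 := smoothing_const_gt0 d10.
have [M M0 uM] := flow_growth fl.
(* In the rim outside [r1], [N' / 2 * hyp] exceeds the bound [M], so the initial data need no point
   masses there. The first entry keeps both radii positive. *)
pose k := Num.min (rho ^+ 2 / 2) (2 * rho / (1 + 2 * M / N')).
have MN : 0 <= 2 * M / N' by rewrite divr_ge0 ?mulr_ge0// ltW.
have rho20 : 0 < rho ^+ 2 by rewrite exprn_gt0.
have k0 : 0 < k by rewrite lt_min !divr_gt0 ?mulr_gt0// ltr_wpDr.
have k2 : k <= rho ^+ 2 / 2 by rewrite ge_min lexx.
have kM : k <= 2 * rho / (1 + 2 * M / N') by rewrite ge_min lexx orbT.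
pose r1 := Num.sqrt (rho ^+ 2 - k); pose r2 := Num.sqrt (rho ^+ 2 - k / 2).
have r1E : r1 ^+ 2 = rho ^+ 2 - k by rewrite sqr_sqrtr//; move: k2 rho20; lra.
have r2E : r2 ^+ 2 = rho ^+ 2 - k / 2 by rewrite sqr_sqrtr//; move: k2 rho20; lra.
have r10 : 0 < r1 by rewrite sqrtr_gt0; move: k2 rho20; lra.
have r20 : 0 < r2 by rewrite sqrtr_gt0; move: k2 rho20; lra.
have r12 : r1 < r2.
  by rewrite -(@ltr_pXn2r _ 2) ?nnegrE ?(ltW r10) ?(ltW r20)// r1E r2E; move: k0; lra.
have r2rho : r2 < rho.
  by rewrite -(@ltr_pXn2r _ 2) ?nnegrE ?(ltW rho0) ?(ltW r20)// r2E; move: k0; lra.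
pose lam := Num.sqrt (N' / (alpha + N')).
have lam0 : 0 < lam by rewrite sqrtr_gt0 divr_gt0// ltr_wpDl.
(* The masses stay within [r2], where [bdepth] is at least [k / 2 / rho]; hence the kernel scale is
   below every truncation scale. *)
pose eps0 := lam * ((k / 2) / rho).
have eps00 : 0 < eps0 by rewrite mulr_gt0// !divr_gt0.
pose kap := 1 + e / (N + 1).
have N10 : 0 < N + 1 by rewrite ltr_wpDl.
have kap1 : 1 < kap by rewrite ltrDl divr_gt0.
have kapN : kap * N <= N'.
  rewrite /kap mulrDl mul1r lerD2l mulrAC ler_pdivrMr// ler_pM2l//.
  by rewrite lerDl.
have N'20 : 0 < N' / 2 by exact: divr_gt0.
have [l [y [c [eps [/andP[eps_gt0 eps_le] ysq c0 sumc disc_f]]]]] :=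
  discretization f_ge0 f_cont u_int r10 r12 (lt_trans r2rho rho1) N'20 kap1 eps00.
have dy p : disc rho (y p).
  by apply: (le_lt_trans (ysq p)); rewrite r2E; move: k0; lra.
have rho1' := ltW rho1.
have u0 z : disc rho z -> u z 0 <= (alpha + N' / 2) * hyp rho z +
    \sum_(p <- l) kap * c p * kernel eps (z.1 - (y p).1) (z.2 - (y p).2).
  move=> dz; have h1 := hyp_ge1 rho0 rho1' dz.
  have h0 := hyp_gt0 rho0 dz.
  have ah : alpha * hyp_factor z <= alpha * hyp rho z.
    by rewrite hyp_factorE ler_wpM2l// hyp1_le.
  have uf : u z 0 - alpha * hyp_factor z <= f z by rewrite le_max lexx.
  have sum0 : 0 <= \sum_(p <- l) c p * kernel eps (z.1 - (y p).1) (z.2 - (y p).2).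
    by apply: sumr_ge0 => p _; rewrite mulr_ge0// kernel_ge0.
  have -> : \sum_(p <- l) kap * c p * kernel eps (z.1 - (y p).1) (z.2 - (y p).2) =
     kap * \sum_(p <- l) c p * kernel eps (z.1 - (y p).1) (z.2 - (y p).2).
    by rewrite mulr_sumr; apply: eq_bigr => p _; rewrite mulrA.
  have N'h : N' / 2 <= N' / 2 * hyp rho z by rewrite ler_peMr// ltW.
  have [dz1|] := ltP (sqnorm z) (r1 ^+ 2).
    by have := disc_f z dz1; move: ah uf N'h; lra.
  rewrite r1E => zk.
  have D0 : 0 < rho ^+ 2 - sqnorm z by rewrite subr_gt0.
  have Mh : 2 * M / N' <= hyp rho z.
    have b1 : 1 + 2 * M / N' <= 2 * rho / (rho ^+ 2 - sqnorm z).
      rewrite ler_pdivlMr// mulrC -ler_pdivlMr; last by rewrite ltr_wpDr.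
      by apply: le_trans kM; move: zk; lra.
    have b2 : 1 <= 1 + 2 * M / N' by rewrite lerDl.
    rewrite /hyp expr2; apply: (@le_trans _ _ (1 + 2 * M / N')); first by rewrite lerDr.
    apply: (@le_trans _ _ ((1 + 2 * M / N') * (1 + 2 * M / N'))).
      by rewrite ler_peMr// (le_trans ler01).
    by apply: ler_pM => //; rewrite (le_trans ler01).
  move: Mh; rewrite ler_pdivrMr// => Mh.
  have [uzM _] := uM z 0 dz ltac:(by rewrite lexx ltW).
  have a1 : 0 <= alpha * hyp rho z by rewrite mulr_ge0// ltW.
  have a2 : 0 <= kap * \sum_(p <- l) c p * kernel eps (z.1 - (y p).1) (z.2 - (y p).2).
    by rewrite mulr_ge0// (le_trans ler01)// ltW.
  by move: Mh uzM a1 a2; lra.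
have kc0 p : 0 <= kap * c p by rewrite mulr_ge0// (le_trans ler01)// ltW.
have ksum : \sum_(p <- l) kap * c p <= N'.
  rewrite -mulr_sumr; apply: le_trans kapN; by rewrite ler_pM2l// (lt_trans ltr01).
have epsD p : eps <= lam * bdepth rho (y p).
  apply: (le_trans eps_le); rewrite /eps0 ler_pM2l// /bdepth ler_pM2r ?invr_gt0//.
  by have := ysq p; rewrite r2E; lra.
pose t1 := (1 + d1) * N' / (4 * pi) + d1 * N' / (4 * pi).
have t1E : t1 = (1 + 2 * d1) * N' / (4 * pi) by rewrite /t1; ring.
have t1t : t1 <= t by rewrite t1E.
have t10 : 0 <= t1.
  by rewrite t1E divr_ge0 ?(ltW pi40)// mulr_ge0 ?(ltW N'0)//; move: d10; lra.
have step z : disc rho z -> u z t1 <= smoothing_const d1 * (alpha + N') * hyp rho z.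
  move=> dz.
  exact: (second_step d10 rho0 rho1' fl al0 N'0 dy kc0 ksum eps_gt0 epsD u0 t1t dz).
have fl1 := regular_flow_shift t10 fl.
have CN0 : 0 < smoothing_const d1 * (alpha + N') by rewrite mulr_gt0// ltr_wpDl.
have tt1 : 0 <= t - t1 <= t - t1 by rewrite lexx subr_ge0 t1t.
have CNe : smoothing_const d1 * (alpha + N') < smoothing_const d1 * (alpha + N') + e.
  by rewrite ltrDl.
have := comparison rho0 rho1' fl1 tt1 CN0 CNe _ dx.
have -> : t1 + (t - t1) = t by rewrite addrC subrK.
rewrite addr0 => /(_ step) h; apply: (le_trans h).
rewrite ler_wpM2r ?(ltW (hyp_gt0 rho0 dx))//.
by move: t10; lra.
Qed.


Lemma time_continuous x t : disc 1 x -> 0 <= t < T -> u x s @[s --> t^'+] --> u x t.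
Proof.
move=> dx tT; have [U [g [oU Up gC gu]]] := local_extension u_smooth dx tT.
have c : (x, s) @[s --> t] --> (x, t).
  by apply: (@cvg_pair _ _ _ _ (nbhs x) (nbhs t)); [exact: cvg_cst|exact: cvg_id].
have gc := Ck_on_continuous (gC 0%N) Up.
have Unear : \forall s \near t^'+, U (x, s).
  by apply: cvg_within; exact: (c U (open_nbhs_nbhs (conj oU Up))).
have h : g (x, s) @[s --> t^'+] --> u x t.
  by rewrite -(gu _ _ Up dx tT); apply: cvg_at_right_filter; exact: (continuous_cvg _ gc c).
have /andP[t0 tT'] := tT.
apply: cvg_trans h; apply: near_eq_cvg; near=> s.
have ts : t < s by near: s; exact: nbhs_right_gt.
apply: gu => //; first by near: s.
by rewrite (le_trans t0 (ltW ts))/=; near: s; exact: nbhs_right_lt.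
Unshelve. all: by end_near. Qed.

(** First rho tends to 1 with e fixed, then e to 0; the constant depends on neither. *)
Lemma bound_pos (delta t : R) x : 0 < delta -> 0 < t -> t < T ->
  N / (4 * pi) * (1 + delta) <= t -> disc 1 x ->
  u x t <= (2 * t + smoothing_const (delta / 4) * (alpha + N)) * hyp 1 x.
Proof.
move=> delta0 t0 tT Nt dx.
pose C := smoothing_const (delta / 4).
have d10 : 0 < delta / 4 by exact: divr_gt0.
have C0 : 0 < C by exact: smoothing_const_gt0.
have h0 := hyp_gt0 ltr01 dx.
have pi40 : 0 < 4 * pi :> R by rewrite mulr_gt0// pi_gt0.
have at_e (e : R) : 0 < e -> (1 + delta / 2) * (N + e) <= 4 * pi * t ->
    u x t <= (2 * t + C * (alpha + (N + e)) + e) * hyp 1 x.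
  move=> e0 hN.
  have cvgh : (2 * t + C * (alpha + (N + e)) + e) * hyp rho x @[rho --> (1:R)^'-] -->
      (2 * t + C * (alpha + (N + e)) + e) * hyp 1 x.
    by apply: cvgMr; exact: hyp_cvg_left.
  apply: (cvgr_to_ge cvgh); near=> rho.
  have rho1 : rho < 1 by near: rho; exact: nbhs_left_lt.
  have rho0 : 0 < rho by near: rho; apply: nbhs_left_gt.
  apply: (bound_at_radius d10 e0 rho0 rho1 t0 tT); last by near: rho; exact: near_disc_left.
  rewrite ler_pdivrMr// [leRHS]mulrC; apply: le_trans hN.
  by have -> : 1 + 2 * (delta / 4) = 1 + delta / 2 by field.
(* The room between the factors 1 + delta and 1 + delta/2, solved for e. *)
pose e0 := 4 * pi * t * (delta / 2) / ((1 + delta) * (1 + delta / 2)).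
have de : 0 < 1 + delta by rewrite addr_gt0.
have d2 : 0 < 1 + delta / 2 by rewrite addr_gt0// divr_gt0.
have pit : 0 < 4 * pi * t by exact: mulr_gt0.
have d20 : 0 < delta / 2 by exact: divr_gt0.
have e00 : 0 < e0 by apply: divr_gt0; exact: mulr_gt0.
have eN e : e <= e0 -> (1 + delta / 2) * (N + e) <= 4 * pi * t.
  rewrite /e0 ler_pdivlMr ?mulr_gt0// => he.
  move: Nt; rewrite mulrAC ler_pdivrMr// => Nt.
  rewrite -(ler_pM2l de); move: (4 * pi) pi40 he Nt => k k0 he Nt.
  have : (1 + delta / 2) * (N * (1 + delta)) <= (1 + delta / 2) * (t * k) by rewrite ler_pM2l.
  by move: he; lra.
apply/ler_addgt0Pr => ep ep0.
pose e := Num.min e0 (ep / ((C + 1) * hyp 1 x)).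
have C1h : 0 < (C + 1) * hyp 1 x by rewrite mulr_gt0// addr_gt0.
have e_gt0 : 0 < e by rewrite lt_min e00 divr_gt0.
have ee : e * ((C + 1) * hyp 1 x) <= ep by rewrite -ler_pdivlMr// ge_min lexx orbT.
have := at_e e e_gt0 (eN e ltac:(by rewrite ge_min lexx)).
by move: ee; rewrite -/C; lra.
Unshelve. all: by end_near. Qed.

(** At t = 0 the time condition persists at every later time, so the bound follows by letting
    positive times decrease to 0. *)
Lemma bound_at delta t x : 0 < delta -> 0 <= t < T ->
  N / (4 * pi) * (1 + delta) <= t -> disc 1 x ->
  u x t <= (2 * t + smoothing_const (delta / 4) * (alpha + N)) * hyp 1 x.
Proof.
move=> delta0 /andP[t0 tT] Nt dx.
case: (ltgtP 0 t) t0 => // [t0 _|t0 _]; first exact: bound_pos.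
rewrite -t0 in Nt tT *.
have cu : u x s @[s --> (0:R)^'+] --> u x 0 by apply: time_continuous => //; rewrite lexx.
set c := smoothing_const _ * _.
have cr : (2 * s + c) * hyp 1 x @[s --> (0:R)^'+] --> (2 * 0 + c) * hyp 1 x.
  apply: cvg_at_right_filter; apply: cvgMl; apply: cvgD; last exact: cvg_cst.
  by apply: cvgMr; exact: cvg_id.
apply: (ler_cvg_to cu cr); near=> s.
have s0 : 0 < s by near: s; exact: nbhs_right_gt.
have sT : s < T by near: s; exact: nbhs_right_lt.
exact: (bound_pos delta0 s0 sT (le_trans Nt (ltW s0)) dx).
Unshelve. all: by end_near. Qed.
End Solution.
End Main.

Unset Implicit Arguments.

Theorem theorem1p3 (R : realType) (delta : R) (hdelta : 0 < delta) :
  exists C : R,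
    forall (T : R) (u : R * R -> R -> R) (alpha : R),
      0 < T ->
      (forall (x : R * R) (t : R), unit_disc x -> 0 <= t < T -> 0 < u x t) ->
      smooth_on (@unit_disc R `*` `[0, T[) (fun p : R * R * R => u p.1 p.2) ->
      log_diffusion T u ->
      0 <= alpha ->
      (@lebesgue2 R).-integrable (@unit_disc R)
        (fun x => (excess alpha (u ^~ 0) x)%:E) ->
      forall t : R, 0 <= t < T ->
        L1norm (excess alpha (u ^~ 0)) / (4 * pi) * (1 + delta) <= t ->
        (ereal_sup [set (u x t / hyp_factor x)%:E | x in @unit_disc R]
          <= (2 * t + C * (alpha + L1norm (excess alpha (u ^~ 0))))%:E)%E.
Proof.
exists (smoothing_const (delta / 4)) => T u alpha T0 u_gt0 u_smooth u_eq al0 u_int t tT Nt.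
apply: ge_ereal_sup => _ [x /unit_discE dx <-]; rewrite lee_fin.
have dx1 := hyp_gt0 ltr01 dx.
rewrite hyp_factorE ler_pdivrMr//.
exact: (bound_at T0 u_gt0 u_smooth u_eq al0 u_int hdelta tT Nt dx).
Qed.
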